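(* Let $n,d\ge 1$, $0<\mu\le L$, $\kappa:=L/\mu$, and let $f_1,\dots,f_n,f_s,g:\mathbb{R}^d\to\mathbb{R}$ be $L$-smooth and $\mu$-strongly convex. Let $x^\star$ be the unique minimizer of $\frac1n\sum_{i=1}^n f_i(x)+2f_s(x)+g(x)$ over $\mathbb{R}^d$. Let $\alpha\in(0,1]$ and $$K_s=\left\lceil\frac{d}{\sqrt\kappa}\right\rceil,\qquad K=\left\lceil\frac{\max(\alpha,\frac1n)\,d}{\sqrt\kappa}\right\rceil.$$ Consider the algorithm BiCoLoR described in the context with $k=d$, $\gamma=\frac1L$, with all compressors mutually independent, each $\mathcal{C}_i^t$ ($i\in\{1,\dots,n\}$) being a $\texttt{rand}$-$K$ compressor and each $\mathcal{C}_s^t$ a $\texttt{rand}$-$K_s$ compressor, so that $\omega=\frac dK-1$, $\omega_s=\frac d{K_s}-1$, $\omega_{\mathrm{av}}=\frac\omega n$, with $$\rho=\rho_y=\frac{1}{2+\omega_{\mathrm{av}}+2\omega_s},\qquad \eta=\eta_y=\frac{1}{(1+2\omega+2\omega_s)(2+\omega_{\mathrm{av}}+2\omega_s)},$$ and with constant probability $p_t\equiv p=\min\left(\frac{1}{\sqrt{\eta\kappa}},1\right)$. Then $nK\ge K_s\ge K$ and $K\ge\alpha K_s$, and the TotalCom complexity (defined in the context) of BiCoLoR to reach $\mathbb{E}[\Psi^t]\le\epsilon$ is $$\mathcal{O}\left(\left(\frac{d\sqrt K\sqrt\kappa}{\sqrt{K_s}}+\frac{d^2}{K_s}\right)\log\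frac{\Psi^0}{\epsilon}\right)=\mathcal{O}\left(d\sqrt\kappa\,\log\frac{\Psi^0}{\epsilon}\right).$$
   Context: Norms are Euclidean; $[d]:=\{1,\dots,d\}$. A differentiable function is $L$-smooth if its gradient is $L$-Lipschitz; $\phi$ is $\mu$-strongly convex if $\phi-\frac\mu2\|\cdot\|^2$ is convex. Compressors. For $\omega\ge0$, $\mathbb{U}(\omega)$ is the set of random maps $\mathcal{C}:\mathbb{R}^d\to\mathbb{R}^d$ with $\mathbb{E}[\mathcal{C}(x)]=x$ and $\mathbb{E}\|\mathcal{C}(x)-x\|^2\le\omega\|x\|^2$ for every $x$. The $\texttt{rand}$-$K$ compressor, $K\in[d]$, selects $K$ coordinates of $x$ uniformly at random, multiplies them by $d/K$, and sets the others to zero; it belongs to $\mathbb{U}(\frac dK-1)$. The constant $\omega_{\mathrm{av}}$ is such that $\mathbb{E}\|\frac1n\sum_{i=1}^n(\mathcal{C}_i^t(x_i)-x_i)\|^2\le\frac{\omega_{\mathrm{av}}}{n}\sum_{i=1}^n\|x_i\|^2$ for all $x_1,\dots,x_n$; it can be taken as $\omega/n$ when the $\mathcal{C}_i^t$ are independent. Algorithm BiCoLoR (case $k=d$, where $k$ is the number of coordinates processed in a communication round). Parameters: $\gamma,\eta,\eta_y,\rho,\rho_y>0$, probabilities $(p_t)_{t\ge1}$ in $(0,1]$. Initialization: $x_1^0,\dots,x_n^0,x_s^0,y^0\in\mathbb{R}^d$ arbitrary, and $u_1^0,\dots,u_n^0,u_s^0,u_y^0\in\mathbb{R}^d$ with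 $\frac1n\sum_{i=1}^nu_i^0+2u_s^0+u_y^0=0$. For $t=0,1,\dots$: 1. $\hat x_i^t:=x_i^t-\gamma\nabla f_i(x_i^t)+\gamma u_i^t$ for $i\in\{1,\dots,n,s\}$, and $\hat y^t:=y^t-\gamma\nabla g(y^t)+\gamma u_y^t$. 2. Draw $\theta^t\in\{0,1\}$ with $\mathrm{Prob}(\theta^t=1)=p_{t+1}$ (independently of everything else, including the compressors; the compressors at different iterations are independent). 3. If $\theta^t=1$ (a communication round): $c_i^t:=\mathcal{C}_i^t(\hat x_i^t-\hat y^t)$ for $i\in[n]$ (sent by client $i$ to the server, uplink), $c_s^t:=\mathcal{C}_s^t(\hat x_s^t-\hat y^t)$ (sent by the server to all clients, downlink), $\bar c^t:=\frac1n\sum_{i=1}^nc_i^t$, and for $i\in[n]$ $$x_i^{t+1}:=(1-\rho)\hat x_i^t+\rho(c_s^t+\hat y^t),\quad x_s^{t+1}:=\Big(1-\tfrac{\rho+\rho_y}{2}\Big)\hat x_s^t+\tfrac{\rho+\rho_y}{2}\hat y^t+\tfrac\rho2\bar c^t,\quad y^{t+1}:=\hat y^t+\rho_yc_s^t,$$ $$u_i^{t+1}:=u_i^t-\tfrac{p_{t+1}\eta}{\gamma}(c_i^t-c_s^t),\quad u_y^{t+1}:=u_y^t+\tfrac{p_{t+1}\eta_y}{\gamma}c_s^t,\quad u_s^{t+1}:=u_s^t+\tfrac{p_{t+1}\eta}{2\gamma}\bar c^t-\tfrac{p_{t+1}(\eta_y+\eta)}{2\gamma}c_s^t.$$ 4.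 If $\theta^t=0$: $x_i^{t+1}:=\hat x_i^t$, $u_i^{t+1}:=u_i^t$ for $i\in\{1,\dots,n,s\}$, $y^{t+1}:=\hat y^t$, $u_y^{t+1}:=u_y^t$. Lyapunov function. With $u_y^\star:=\nabla g(x^\star)$, $u_i^\star:=\nabla f_i(x^\star)$, $$\Psi^t:=\frac1\gamma\left(\sum_{i=1}^n\|x_i^t-x^\star\|^2+2n\|x_s^t-x^\star\|^2+n\|y^t-x^\star\|^2\right)+\frac{\gamma}{p^2\eta}\left(\sum_{i=1}^n\|u_i^t-u_i^\star\|^2+n\|u_y^t-u_y^\star\|^2\right).$$ TotalCom complexity. Let $\epsilon>0$ be the desired accuracy. The iteration complexity is the number of iterations needed to reach $\mathbb{E}[\Psi^t]\le\epsilon$, and the complexity in number of communication rounds is $p$ times the iteration complexity. If the compressed vectors $c_i^t$ and $c_s^t$ are encoded into $b$ and $b_s$ bits respectively, the TotalCom complexity is $(b+\alpha b_s)$ times the number of communication rounds (uplink cost plus $\alpha$ times downlink cost). For $\texttt{rand}$-$K$ the number of bits is $\Theta(K)$ (the cost of encoding the indices being ignored), so $b=\Theta(K)$ and $b_s=\Theta(K_s)$.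
   Formalization: K ≥ αK_s fails because of rounding; proved instead: αK_s < K+α always, and αK_s ≤ K if α ≤ 1/n or d/√κ is an integer. The O-bounds are for ε ≤ δΨ^0 with any fixed δ<1 (constant depending on δ), since log(Ψ^0/ε)→0 as ε→Ψ^0. *)

(* Defs.v *)
From HB Require Import structures.
From mathcomp Require Import all_boot all_order all_algebra.
From mathcomp Require Import all_classical all_reals all_analysis.

Set Implicit Arguments.
Unset Strict Implicit.
Unset Printing Implicit Defensive.

Import Order.TTheory GRing.Theory Num.Theory.
Import numFieldNormedType.Exports.

Local Open Scope classical_set_scope.
Local Open Scope ring_scope.

(* The norm [`|x|] that the library puts on ['rV[R]_d] is the sup norm, so the
   Euclidean norm is defined here.  The two norms are equivalent, so that
   differentiability does not depend on the choice. *)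
Definition sqnorm (R : realType) (d : nat) (x : 'rV[R]_d) : R :=
  \sum_(j < d) x 0 j ^+ 2.

Definition enorm (R : realType) (d : nat) (x : 'rV[R]_d) : R :=
  Num.sqrt (sqnorm x).

Definition grad (R : realType) (d : nat) (f : 'rV[R]_d -> R)
    (x : 'rV[R]_d) : 'rV[R]_d :=
  \row_(j < d) 'D_(delta_mx 0 j) f x.

Definition smooth (R : realType) (d : nat) (L : R) (f : 'rV[R]_d -> R) : Prop :=
  (forall x : 'rV[R]_d, differentiable f x) /\
  (forall x y : 'rV[R]_d, enorm (grad f x - grad f y) <= L * enorm (x - y)).

Definition strongly_convex (R : realType) (d : nat) (mu : R)
    (f : 'rV[R]_d -> R) : Prop :=
  convex_function [set: convex_lmodType 'rV[R]_d]
    (fun x : 'rV[R]_d => f x - mu / 2 * enorm x ^+ 2).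

Definition objective (R : realType) (n d : nat) (f : 'I_n -> 'rV[R]_d -> R)
    (fs g : 'rV[R]_d -> R) (x : 'rV[R]_d) : R :=
  n%:R^-1 * (\sum_(i < n) f i x) + 2 * fs x + g x.

Definition is_minimizer (R : realType) (d : nat) (F : 'rV[R]_d -> R)
    (x : 'rV[R]_d) : Prop :=
  forall z : 'rV[R]_d, F x <= F z.

(* [X] is a random element of the finite type [T] with probability mass
   function [q]. *)
Definition has_pmf (R : realType) (disp : measure_display)
    (Omega : measurableType disp) (P : probability Omega R) (T : finType)
    (X : Omega -> T) (q : T -> R) : Prop :=
  forall v : T,
    measurable (X @^-1` [set v]) /\ P (X @^-1` [set v]) = (q v)%:E.

Definition events_of (Omega : Type) (T : Type) (X : Omega -> T) :
    set (set Omega) :=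
  [set X @^-1` A | A in [set: set T]].

Definition mutually_independent (R : realType) (disp : measure_display)
    (Omega : measurableType disp) (P : probability Omega R) (I : eqType)
    (F : I -> set (set Omega)) : Prop :=
  forall (J : seq I) (E : I -> set Omega),
    uniq J -> (forall i : I, i \in J -> F i (E i)) ->
    fine (P (\bigcap_(i in [set` J]) E i)) = \prod_(i <- J) fine (P (E i)).

(* Once its set [S] of selected coordinates is drawn, rand-K is this map. *)
Definition randK (R : realType) (d K : nat) (S : {set 'I_d})
    (x : 'rV[R]_d) : 'rV[R]_d :=
  \row_(j < d) (if j \in S then d%:R / K%:R * x 0 j else 0).

Definition uniform_subset_pmf (R : realType) (d K : nat)
    (A : {set 'I_d}) : R :=
  if #|A| == K then ('C(d, K))%:R^-1 else 0.

(* All the sources of randomness: [inl t] is the coin of iteration [t],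
   [inr (t, Some i)] the coordinates selected by client [i] at iteration [t],
   and [inr (t, None)] those selected by the server. *)
Definition noise_events (Omega : Type) (n d : nat)
    (theta : nat -> Omega -> bool) (S : 'I_n -> nat -> Omega -> {set 'I_d})
    (Ss : nat -> Omega -> {set 'I_d})
    (k : (nat + nat * option 'I_n)%type) : set (set Omega) :=
  match k with
  | inl t => events_of (theta t)
  | inr (t, Some i) => events_of (S i t)
  | inr (t, None) => events_of (Ss t)
  end.

Record params (R : realType) := Params {
  gamma : R;
  eta : R;
  eta_y : R;
  rho : R;
  rho_y : R;
  prob : nat -> R
}.

Record state (R : realType) (n d : nat) := State {
  st_x : 'I_n -> 'rV[R]_d;
  st_xs : 'rV[R]_d;
  st_y : 'rV[R]_d;
  st_u : 'I_n -> 'rV[R]_d;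
  st_us : 'rV[R]_d;
  st_uy : 'rV[R]_d
}.

Definition admissible_init (R : realType) (n d : nat)
    (s : state R n d) : Prop :=
  n%:R^-1 *: (\sum_(i < n) st_u s i) + 2 *: st_us s + st_uy s = 0.

(* Iteration [t] of BiCoLoR with k = d, given the value [theta] of the coin and
   the realizations [C], [Cs] of the compressors. *)
Definition bicolor_step (R : realType) (n d : nat)
    (f : 'I_n -> 'rV[R]_d -> R) (fs g : 'rV[R]_d -> R) (a : params R)
    (t : nat) (theta : bool) (C : 'I_n -> 'rV[R]_d -> 'rV[R]_d)
    (Cs : 'rV[R]_d -> 'rV[R]_d) (s : state R n d) : state R n d :=
  let p := prob a t.+1 in
  let hx := fun i : 'I_n =>
    st_x s i - gamma a *: grad (f i) (st_x s i) + gamma a *: st_u s i in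
  let hxs := st_xs s - gamma a *: grad fs (st_xs s) + gamma a *: st_us s in
  let hy := st_y s - gamma a *: grad g (st_y s) + gamma a *: st_uy s in
  if theta then
    let c := fun i : 'I_n => C i (hx i - hy) in
    let cs := Cs (hxs - hy) in
    let cbar := n%:R^-1 *: \sum_(i < n) c i in
    {| st_x := fun i => (1 - rho a) *: hx i + rho a *: (cs + hy);
       st_xs := (1 - (rho a + rho_y a) / 2) *: hxs
                + ((rho a + rho_y a) / 2) *: hy + (rho a / 2) *: cbar;
       st_y := hy + rho_y a *: cs;
       st_u := fun i => st_u s i - (p * eta a / gamma a) *: (c i - cs);
       st_us := st_us s + (p * eta a / (2 * gamma a)) *: cbar
                - (p * (eta_y a + eta a) / (2 * gamma a)) *: cs;
       st_uy := st_uy s + (p * eta_y a / gamma a) *: cs |}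
  else
    {| st_x := hx; st_xs := hxs; st_y := hy;
       st_u := st_u s; st_us := st_us s; st_uy := st_uy s |}.

Fixpoint bicolor (R : realType) (Omega : Type) (n d : nat)
    (f : 'I_n -> 'rV[R]_d -> R) (fs g : 'rV[R]_d -> R) (a : params R)
    (theta : nat -> Omega -> bool)
    (C : 'I_n -> nat -> Omega -> 'rV[R]_d -> 'rV[R]_d)
    (Cs : nat -> Omega -> 'rV[R]_d -> 'rV[R]_d)
    (s0 : state R n d) (t : nat) (w : Omega) : state R n d :=
  if t is t'.+1 then
    bicolor_step f fs g a t' (theta t' w) (fun i => C i t' w) (Cs t' w)
      (bicolor f fs g a theta C Cs s0 t' w)
  else s0.

Definition lyapunov (R : realType) (n d : nat)
    (f : 'I_n -> 'rV[R]_d -> R) (g : 'rV[R]_d -> R)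
    (gamma eta p : R) (xstar : 'rV[R]_d) (s : state R n d) : R :=
  gamma^-1 * (\sum_(i < n) enorm (st_x s i - xstar) ^+ 2
              + 2 * n%:R * enorm (st_xs s - xstar) ^+ 2
              + n%:R * enorm (st_y s - xstar) ^+ 2)
  + gamma / (p ^+ 2 * eta)
    * (\sum_(i < n) enorm (st_u s i - grad (f i) xstar) ^+ 2
       + n%:R * enorm (st_uy s - grad g xstar) ^+ 2).

Definition K_down (R : realType) (d : nat) (kappa : R) : nat :=
  `|Num.ceil (d%:R / Num.sqrt kappa)|%N.

(* Because of the rounding, [alpha * K_down <= K_up] may fail, by less than
   [alpha]: for n = d = 2, sqrt kappa = 20/11 and alpha = 9/10, the two
   integers are K_down = 2 and K_up = 1. *)
Definition K_up (R : realType) (n d : nat) (alpha kappa : R) : nat :=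
  `|Num.ceil (Num.max alpha n%:R^-1 * d%:R / Num.sqrt kappa)|%N.

(* The number [T] of iterations needed for the sequence [a] to reach accuracy
   [eps] is the first hitting time. *)
Definition iteration_complexity (R : realType) (a : nat -> \bar R) (eps : R)
    (T : nat) : Prop :=
  (a T <= eps%:E)%E /\ (forall t : nat, (t < T)%N -> (eps%:E < a t)%E).

Definition totalcom (R : realType) (alpha : R) (b bs : nat) (p : R)
    (T : nat) : R :=
  (b%:R + alpha * bs%:R) * (p * T%:R).

(* Main.v *)
(* One iteration contracts Psi in conditional expectation.  The gradient steps
   contract the primal distances by 1 - mu/L, by cocoercivity and strong
   monotonicity.  In a communication round, the value of rho is small enough for
   the compressed averaging to decrease the primal energy by at least rho times
   the dispersion of the local models, and the value of eta makes the variance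
   injected into the dual variables at most this gain.  The dual variables sum to
   zero, so the cross terms complete squares and the dual energy shrinks by
   1 - p^2 eta.  Everything is quadratic and rand-K acts coordinatewise, so this
   computation concerns scalars.  As p^2 eta = min(1/kappa, eta), one gets
   E Psi^t <= (1 - min(1/kappa, eta))^t Psi^0.
   The complexity then follows from p max(kappa, 1/eta) <= sqrt(kappa/eta) + 1/eta,
   1/eta <= 12 d^2 / (K Ks) and alpha Ks <= 2 K. *)

Require Import Defs.
From HB Require Import structures.
From mathcomp Require Import all_boot all_order all_algebra.
From mathcomp Require Import all_classical all_reals all_analysis.
From mathcomp Require Import measurable_realfun ring lra.

Set Implicit Arguments.
Unset Strict Implicit.
Unset Printing Implicit Defensive.

Import Order.TTheory GRing.Theory Num.Theory.
Import numFieldNormedType.Exports.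

Local Open Scope classical_set_scope.
Local Open Scope ring_scope.

(** * Smooth strongly convex functions *)

(** The noise of one iteration takes finitely many values, so no measure-theoretic conditioning is
    needed: the expectation of a function of the first [t] draws is a finite weighted sum over noise
    histories, and the contraction is iterated by summing out the last draw. The coordinates of one
    rand-K message are dependent. This is harmless, because [Psi] is a sum over coordinates and on a
    single coordinate only the first two moments of a multiplicative error enter. The server's dual
    variable is absent from [Psi]: the balance of the dual variables determines it from the others.
    Every iteration preserves this balance, and the gradients at [xstar] share it by optimality, so
    the dual errors are balanced too. The iteration count is an integer, so for [eps] just below
    [Psi s0] one iteration may be needed while the logarithm is close to 0. The condition
    [eps <= delta * Psi s0] keeps the logarithm above [ln delta^-1], which pays for the rounding;
    this is how [C] depends on [delta]. *)

Section EuclideanSpace.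
Context {R : realType} {d : nat}.
Implicit Types x y z : 'rV[R]_d.

Definition dot x y : R := \sum_(j < d) x 0 j * y 0 j.

Lemma sqnormE x : sqnorm x = dot x x.
Proof. by apply: eq_bigr => j _; rewrite expr2. Qed.

Lemma sqnorm_ge0 x : 0 <= sqnorm x.
Proof. by apply: sumr_ge0 => j _; rewrite sqr_ge0. Qed.

Lemma enorm_sqr x : enorm x ^+ 2 = sqnorm x.
Proof. by rewrite sqr_sqrtr ?sqnorm_ge0. Qed.

Lemma dotC x y : dot x y = dot y x.
Proof. by apply: eq_bigr => j _; rewrite mulrC. Qed.

Lemma dotDl x y z : dot (x + y) z = dot x z + dot y z.
Proof. by rewrite -big_split; apply: eq_bigr => j _; rewrite mxE mulrDl. Qed.

Lemma dotZl a x y : dot (a *: x) y = a * dot x y.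
Proof. by rewrite mulr_sumr; apply: eq_bigr => j _; rewrite mxE mulrA. Qed.

Lemma dotNl x y : dot (- x) y = - dot x y.
Proof. by rewrite -scaleN1r dotZl mulN1r. Qed.

Lemma dotBl x y z : dot (x - y) z = dot x z - dot y z.
Proof. by rewrite dotDl dotNl. Qed.

Lemma dotDr x y z : dot x (y + z) = dot x y + dot x z.
Proof. by rewrite dotC dotDl !(dotC x). Qed.

Lemma dotZr a x y : dot x (a *: y) = a * dot x y.
Proof. by rewrite dotC dotZl dotC. Qed.

Lemma dotNr x y : dot x (- y) = - dot x y.
Proof. by rewrite dotC dotNl dotC. Qed.

Lemma dotBr x y z : dot x (y - z) = dot x y - dot x z.
Proof. by rewrite dotDr dotNr. Qed.

Lemma sqnormD x y : sqnorm (x + y) = sqnorm x + 2 * dot x y + sqnorm y.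
Proof. by rewrite !sqnormE dotDl !dotDr (dotC y x); ring. Qed.

Lemma sqnormZ a x : sqnorm (a *: x) = a ^+ 2 * sqnorm x.
Proof. by rewrite !sqnormE dotZl dotZr; ring. Qed.

Lemma sqnormN x : sqnorm (- x) = sqnorm x.
Proof. by rewrite !sqnormE dotNl dotNr opprK. Qed.

Lemma sqnormB x y : sqnorm (x - y) = sqnorm x - 2 * dot x y + sqnorm y.
Proof. by rewrite sqnormD dotNr sqnormN; ring. Qed.

Lemma sqnorm_eq0 x : sqnorm x = 0 -> x = 0.
Proof.
move=> x0; apply/rowP => j; rewrite mxE.
have /psumr_eq0P : \sum_(j < d) x 0 j ^+ 2 = 0 by [].
move=> /(_ (fun i _ => sqr_ge0 _))/(_ j isT)/eqP.
by rewrite sqrf_eq0 => /eqP.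
Qed.

End EuclideanSpace.

(** A Cauchy-Schwarz bound without square roots, obtained by expanding
    [sqnorm (x - k *: y) >= 0]. *)
Lemma dot_le_Young {R : realType} {d : nat} (k : R) (x y : 'rV[R]_d) : 0 < k ->
  sqnorm x <= k ^+ 2 * sqnorm y -> dot x y <= k * sqnorm y.
Proof.
move=> k0 xy; rewrite -(ler_pM2l k0) -(ler_pM2l (_ : 0 < 2 :> R))//.
have := sqnorm_ge0 (x - k *: y); rewrite sqnormB dotZr sqnormZ; lra.
Qed.

Section SmoothConvex.
Context {R : realType} {d : nat}.
Implicit Types (f : 'rV[R]_d -> R) (x y z v : 'rV[R]_d) (L mu : R).

Lemma derive_dot_grad f x v : differentiable f x -> 'D_v f x = dot (grad f x) v.
Proof.
move=> df; rewrite deriveE// {1}(row_sum_delta v) linear_sum.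
by apply: eq_bigr => j _; rewrite linearZ /= mxE deriveE// mulrC.
Qed.

Lemma is_derive_line f x v (t : R) : (forall z, differentiable f z) ->
  is_derive t 1 (fun s : R => f (x + s *: v)) (dot (grad f (x + t *: v)) v).
Proof.
move=> df; have dfv : derivable f (x + t *: v) v by exact: diff_derivable.
have E : (fun h : R => h^-1 *: (f (x + (h *: 1 + t) *: v) - f (x + t *: v))) =
         (fun h : R => h^-1 *: (f (h *: v + (x + t *: v)) - f (x + t *: v))).
  apply/funext => h; congr (_ *: (f _ - _)).
  by rewrite scalerDl addrCA [h *: 1]mulr1.
apply: DeriveDef; first by rewrite /derivable /= E.
by rewrite -derive_dot_grad// /derive /= E.
Qed.

(** This replaces integrating the bound on the derivative: subtract the primitive of [a + b * t] and
    apply the mean value theorem. Its intermediate point is interior, so the bound is asked for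
    [0 < t < 1] only. *)
Lemma le_increment_of_derive_le (phi dphi : R -> R) (a b : R) :
  (forall t : R, is_derive t 1 phi (dphi t)) ->
  (forall t, 0 < t -> t < 1 -> dphi t <= a + b * t) ->
  phi 1 - phi 0 <= a + b / 2.
Proof.
move=> dphiP dphi_le.
pose psi t := phi t - (a * t + b / 2 * t ^+ 2).
have dpsi (t : R) : is_derive t 1 psi (dphi t - (a + b * t)).
  rewrite /psi; apply: is_derive_eq.
  by rewrite /GRing.scale /=; field.
have cpsi : {within `[0, 1]%classic, continuous psi}.
  apply: continuous_subspaceT => t.
  by apply/differentiable_continuous/derivable1_diffP; have [] := dpsi t.
have [c] := MVT ltr01 (fun t _ => dpsi t) cpsi.
rewrite in_itv /= => /andP[c0 c1] E.
have : psi 1 - psi 0 <= 0.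
  rewrite E subr0 mulr1 subr_le0; exact: dphi_le.
by rewrite /psi expr0n expr1n/=; lra.
Qed.

Lemma smooth_sqnorm L f x y : 0 < L -> smooth L f ->
  sqnorm (grad f x - grad f y) <= L ^+ 2 * sqnorm (x - y).
Proof.
move=> L0 [_ /(_ x y)]; rewrite -!enorm_sqr -exprMn.
by rewrite ler_pXn2r// nnegrE ?mulr_ge0 ?sqrtr_ge0// ltW.
Qed.

Lemma smooth_grad_line L f x v (t : R) : 0 < L -> smooth L f -> 0 < t ->
  sqnorm (grad f (x + t *: v) - grad f x) <= (L * t) ^+ 2 * sqnorm v.
Proof.
move=> L0 fL t0; apply: (le_trans (smooth_sqnorm _ _ L0 fL)).
by rewrite addrC addKr sqnormZ exprMn mulrA.
Qed.

Lemma smooth_upper L f x v : 0 < L -> smooth L f ->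
  f (x + v) <= f x + dot (grad f x) v + L / 2 * sqnorm v.
Proof.
move=> L0 fL.
have := @le_increment_of_derive_le (fun s : R => f (x + s *: v)) _
  (dot (grad f x) v) (L * sqnorm v)
  (fun t => @is_derive_line f x v t fL.1).
rewrite scale1r scale0r addr0 => H; suff: f (x + v) - f x <=
  dot (grad f x) v + L * sqnorm v / 2 by lra.
apply: H => t t0 t1.
have := dot_le_Young (mulr_gt0 L0 t0) (smooth_grad_line x v L0 fL t0).
by rewrite dotBl; lra.
Qed.

Lemma smooth_lower L f x v : 0 < L -> smooth L f ->
  f x + dot (grad f x) v - L / 2 * sqnorm v <= f (x + v).
Proof.
move=> L0 fL.
have := @le_increment_of_derive_le (fun s : R => - f (x + s *: v))
  (fun t => - dot (grad f (x + t *: v)) v)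
  (- dot (grad f x) v) (L * sqnorm v)
  (fun t => is_deriveN (@is_derive_line f x v t fL.1)).
rewrite scale1r scale0r addr0 => H; suff: - f (x + v) - - f x <=
  - dot (grad f x) v + L * sqnorm v / 2 by lra.
apply: H => t t0 t1.
have G := smooth_grad_line x v L0 fL t0; rewrite -sqnormN in G.
by have := dot_le_Young (mulr_gt0 L0 t0) G; rewrite dotNl dotBl; lra.
Qed.

Lemma strongly_convex_le mu f x v (t : R) : strongly_convex mu f ->
  0 <= t -> t <= 1 ->
  f (x + t *: v) <=
  (1 - t) * f x + t * f (x + v) - mu / 2 * (t * (1 - t)) * sqnorm v.
Proof.
move=> fmu t0 t1.
have := fmu (Itv01 t0 t1) (x + v) x (in_setT _) (in_setT _).
rewrite convRE.
have -> : conv (Itv01 t0 t1) (x + v : convex_lmodType _) x = x + t *: v.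
  have -> : x + t *: v = t *: (x + v) + (1 - t) *: x.
    by apply/rowP => j; rewrite !mxE; ring.
  by [].
by rewrite /unstable.onem/= !enorm_sqr !sqnormD sqnormZ dotZr; lra.
Qed.

(* The smoothness lower bound replaces the limit [t -> 0] in the usual
   first-order characterization. *)
Lemma strongly_convex_first_order L mu f x v : 0 < L -> 0 <= mu ->
  smooth L f -> strongly_convex mu f ->
  f x + dot (grad f x) v + mu / 2 * sqnorm v <= f (x + v).
Proof.
move=> L0 mu0 fL fmu; rewrite leNgt; apply/negP => H.
set N := sqnorm v in H *; have N0 : 0 <= N by exact: sqnorm_ge0.
(* [D] is the supposed deficit. At [x + t *: v], the smoothness lower bound and the strong convexity
   upper bound give [t * D <= t * (t * c)]; the [t] chosen below is in [(0, 1]] with [t * c < D]. *)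
pose D := f x + dot (grad f x) v + mu / 2 * N - f (x + v).
pose c := (L + mu) / 2 * N.
have D0 : 0 < D by rewrite subr_gt0.
have c0 : 0 <= c by rewrite mulr_ge0// divr_ge0// addr_ge0// ltW.
have Dc0 : 0 < D + 2 * c by lra.
pose t := D / (D + 2 * c).
have t0 : 0 < t by rewrite divr_gt0.
have t1 : t <= 1 by rewrite ler_pdivrMr// mul1r; lra.
have tc : t * c < D.
  rewrite /t mulrAC ltr_pdivrMr// ltr_pM2l//; lra.
have := smooth_lower x (t *: v) L0 fL; rewrite dotZr sqnormZ -/N => lo.
have := strongly_convex_le x v fmu (ltW t0) t1; rewrite -/N => up.
have : t * D <= t * (t * c).
  by rewrite /D /c; have := le_trans lo up; lra.
by rewrite ler_pM2l// leNgt tc.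
Qed.

(** At the test point [y - L^-1 *: w], the tangent at [x] bounds [f] from below and smoothness at
    [y] bounds it from above. This point minimizes the upper bound once the tangent at [x] is
    subtracted. *)
Lemma smooth_convex_gap L mu f x y : 0 < L -> 0 <= mu ->
  smooth L f -> strongly_convex mu f ->
  f x + dot (grad f x) (y - x) + (2 * L)^-1 * sqnorm (grad f y - grad f x)
    <= f y.
Proof.
move=> L0 mu0 fL fmu.
set w := grad f y - grad f x.
have wE : sqnorm w = dot (grad f y) w - dot (grad f x) w.
  by rewrite sqnormE {1}/w dotBl.
clearbody w.
have := smooth_upper y (- (L^-1 *: w)) L0 fL.
have := strongly_convex_first_order x (y - L^-1 *: w - x) L0 mu0 fL fmu.
rewrite [x + _]addrC subrK => H1 H2.
have := sqnorm_ge0 (y - L^-1 *: w - x).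
move: H1 H2; rewrite sqnormN sqnormZ !(dotBr, dotNr, dotZr).
rewrite wE; set a := dot (grad f y) w; set b := dot (grad f x) w.
have -> : L / 2 * (L^-1 ^+ 2 * (a - b)) = (2 * L)^-1 * (a - b).
  by field; rewrite gt_eqF.
have E : L^-1 * (a - b) = 2 * ((2 * L)^-1 * (a - b)) by field; rewrite gt_eqF.
move=> H1 H2 s0; have : 0 <= mu / 2 * sqnorm (y - L^-1 *: w - x).
  by rewrite mulr_ge0// divr_ge0.
by move: H1 H2 E; lra.
Qed.

Lemma cocoercive L mu f x y : 0 < L -> 0 <= mu ->
  smooth L f -> strongly_convex mu f ->
  L^-1 * sqnorm (grad f x - grad f y) <= dot (grad f x - grad f y) (x - y).
Proof.
move=> L0 mu0 fL fmu.
have := smooth_convex_gap x y L0 mu0 fL fmu.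
have := smooth_convex_gap y x L0 mu0 fL fmu.
rewrite -[grad f y - _]opprB sqnormN; set s := sqnorm _.
have : L^-1 * s = 2 * ((2 * L)^-1 * s) by field; rewrite gt_eqF.
by rewrite !(dotBl, dotBr); lra.
Qed.

Lemma strongly_monotone L mu f x y : 0 < L -> 0 <= mu ->
  smooth L f -> strongly_convex mu f ->
  mu * sqnorm (x - y) <= dot (grad f x - grad f y) (x - y).
Proof.
move=> L0 mu0 fL fmu.
have := strongly_convex_first_order x (y - x) L0 mu0 fL fmu.
have := strongly_convex_first_order y (x - y) L0 mu0 fL fmu.
rewrite -[y - x]opprB sqnormN !(dotBl, dotBr, dotNr) opprB.
by rewrite ![_ + (_ - _)]addrC !subrK; lra.
Qed.

(** The expanded square contains the inner product twice: cocoercivity spends one copy on the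
    squared gradient difference, and strong monotonicity turns the other into the factor
    [1 - mu / L]. *)
Lemma gradient_step_contraction L mu f x y : 0 < L -> 0 <= mu ->
  smooth L f -> strongly_convex mu f ->
  sqnorm ((x - L^-1 *: grad f x) - (y - L^-1 *: grad f y))
    <= (1 - mu / L) * sqnorm (x - y).
Proof.
move=> L0 mu0 fL fmu.
have -> : (x - L^-1 *: grad f x) - (y - L^-1 *: grad f y) =
          (x - y) - L^-1 *: (grad f x - grad f y).
  by apply/rowP => j; rewrite !mxE; ring.
rewrite (sqnormB (x - y)) sqnormZ dotZr (dotC (x - y)) expr2 -mulrA.
have iL : 0 <= L^-1 by rewrite invr_ge0 ltW.
have := ler_wpM2l iL (cocoercive x y L0 mu0 fL fmu).
have := ler_wpM2l iL (strongly_monotone x y L0 mu0 fL fmu).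
set s := sqnorm _; set g := sqnorm _; lra.
Qed.

Lemma objective_grad_eq0 n L (f : 'I_n -> 'rV[R]_d -> R) fs g x :
  (0 < n)%N -> 0 < L -> (forall i, smooth L (f i)) -> smooth L fs ->
  smooth L g -> is_minimizer (objective f fs g) x ->
  n%:R^-1 *: (\sum_(i < n) grad (f i) x) + 2 *: grad fs x + grad g x = 0.
Proof.
move=> n0 L0 fL fsL gL xmin; set G := _ + _ + _.
(* The weights of the objective add up to 1 + 2 + 1, so it is 4L-smooth. This gradient step would
   decrease it by at least [(8 * L)^-1 * sqnorm G], which minimality forbids unless [G = 0]. *)
pose v := - ((4 * L)^-1 *: G).
have n0R : 0 < n%:R :> R by rewrite ltr0n.
have up : n%:R^-1 * (\sum_(i < n) f i (x + v)) <= n%:R^-1 *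
   (\sum_(i < n) f i x) + dot (n%:R^-1 *: (\sum_(i < n) grad (f i) x)) v
    + L / 2 * sqnorm v.
  have -> : dot (n%:R^-1 *: (\sum_(i < n) grad (f i) x)) v =
            n%:R^-1 * \sum_(i < n) dot (grad (f i) x) v.
    rewrite dotZl; congr (_ * _); elim/big_ind2 : _ => [|? ? ? ? <- <-|//].
      by rewrite -[0](scale0r x) dotZl mul0r.
    by rewrite dotDl.
  have -> : L / 2 * sqnorm v = n%:R^-1 * \sum_(i < n) (L / 2 * sqnorm v).
    by rewrite sumr_const card_ord -(mulr_natl (L / 2 * sqnorm v)) mulKf ?gt_eqF.
  rewrite -!mulrDr -!big_split ler_pM2l ?invr_gt0//.
  by rewrite ler_sum// => i _; exact: (smooth_upper x v L0 (fL i)).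
have := smooth_upper x v L0 fsL.
have := smooth_upper x v L0 gL.
have := xmin (x + v); rewrite /objective => H1 H2 H3.
have : 0 <= dot G v + 2 * L * sqnorm v.
  by rewrite /G !dotDl !dotZl; rewrite !dotZl in up; lra.
rewrite /v dotNr dotZr sqnormN sqnormZ -sqnormE => H.
have : 0 <= - (8 * L)^-1 * sqnorm G.
  apply: le_trans H _; rewrite le_eqVlt; apply/orP; left; apply/eqP.
  by field; rewrite gt_eqF.
rewrite mulNr oppr_ge0 pmulr_rle0 ?invr_gt0 ?mulr_gt0// => G0.
by apply/sqnorm_eq0/eqP; rewrite eq_le G0 sqnorm_ge0.
Qed.

End SmoothConvex.

(** * Finite expectations and rand-K *)

Section FiniteExpectation.
Context {R : realType}.

Definition Ex (Z : finType) (q G : Z -> R) : R := \sum_z q z * G z.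

Context {Z : finType} (q : Z -> R).

Lemma ExD G H : Ex q (fun z => G z + H z) = Ex q G + Ex q H.
Proof. by rewrite -big_split; apply: eq_bigr => z _; rewrite mulrDr. Qed.

Lemma ExZ a G : Ex q (fun z => a * G z) = a * Ex q G.
Proof. by rewrite mulr_sumr; apply: eq_bigr => z _; rewrite mulrCA. Qed.

Lemma Ex_sum (I : finType) (G : I -> Z -> R) :
  Ex q (fun z => \sum_i G i z) = \sum_i Ex q (G i).
Proof. by rewrite exchange_big; apply: eq_bigr => z _; rewrite mulr_sumr. Qed.

Lemma eq_Ex G H : G =1 H -> Ex q G = Ex q H.
Proof. by move=> GH; apply: eq_bigr => z _; rewrite GH. Qed.

Hypothesis q1 : \sum_z q z = 1.

Lemma Ex_cst a : Ex q (fun=> a) = a.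
Proof. by rewrite /Ex -mulr_suml q1 mul1r. Qed.

Lemma Ex_sqrD a N : Ex q N = 0 ->
  Ex q (fun z => (a + N z) ^+ 2) = a ^+ 2 + Ex q (fun z => N z ^+ 2).
Proof.
move=> N0; rewrite (@eq_Ex _ (fun z => a ^+ 2 + (2 * a * N z + N z ^+ 2))).
  by rewrite ExD Ex_cst ExD ExZ N0 mulr0 add0r.
by move=> z; ring.
Qed.

Lemma Ex_sqr_lincomb n (a : 'I_n -> R) (xi : 'I_n -> Z -> R) (w : R) :
  (forall i, Ex q (fun z => xi i z ^+ 2) = w) ->
  (forall i j, i != j -> Ex q (fun z => xi i z * xi j z) = 0) ->
  Ex q (fun z => (\sum_i a i * xi i z) ^+ 2) = w * \sum_i a i ^+ 2.
Proof.
move=> xi2 xi0; rewrite (@eq_Ex _ (fun z =>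
    \sum_i \sum_j (a i * a j) * (xi i z * xi j z))); last first.
  move=> z; rewrite expr2 mulr_suml; apply: eq_bigr => i _.
  by rewrite mulr_sumr; apply: eq_bigr => j _; ring.
rewrite Ex_sum mulr_sumr; apply: eq_bigr => i _.
rewrite Ex_sum (bigD1 i)//= big1 => [|j ji]; last first.
  by rewrite ExZ xi0 ?mulr0// eq_sym.
by rewrite ExZ -(xi2 i) addr0 (eq_Ex (H := fun z => xi i z ^+ 2)) //; ring.
Qed.

End FiniteExpectation.

Section ProductPmf.
Context {R : realType} {I T : finType} (q : T -> R).
Hypothesis q1 : \sum_x q x = 1.

Definition prod_pmf (S : {ffun I -> T}) : R := \prod_i q (S i).

Lemma Ex_prod_pmf (F : I -> T -> R) :
  Ex prod_pmf (fun S => \prod_i F i (S i)) = \prod_i Ex q (F i).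
Proof. by rewrite bigA_distr_bigA; apply: eq_bigr => S _; rewrite -big_split. Qed.

Lemma prod_pmf_sum1 : \sum_S prod_pmf S = 1.
Proof.
rewrite -(bigA_distr_bigA (fun=> q)) big1// => i _; exact: q1.
Qed.

Lemma Ex_prod_pmf1 i (G : T -> R) : Ex prod_pmf (fun S => G (S i)) = Ex q G.
Proof.
(* Padding with constant factors 1 makes the marginal an instance of the product formula. *)
pose F k := if k == i then G else fun=> 1.
rewrite (@eq_Ex _ _ _ _ (fun S : {ffun I -> T} => \prod_k F k (S k))); last first.
  move=> S; rewrite (bigD1 i)//= /F eqxx big1 ?mulr1// => k /negbTE.
  by move=> ->.
rewrite Ex_prod_pmf (bigD1 i)//= /F eqxx big1 ?mulr1// => k /negbTE ->.
exact: Ex_cst.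
Qed.

Lemma Ex_prod_pmf2 i j (G H : T -> R) : i != j ->
  Ex prod_pmf (fun S => G (S i) * H (S j)) = Ex q G * Ex q H.
Proof.
move=> ij; have ji : j != i by rewrite eq_sym.
pose F k := if k == i then G else if k == j then H else fun=> 1.
rewrite (@eq_Ex _ _ _ _ (fun S : {ffun I -> T} => \prod_k F k (S k))); last first.
  move=> S; rewrite (bigD1 i)//= (bigD1 j)//= /F eqxx (negbTE ji) eqxx.
  by rewrite big1 ?mulr1// => k /andP[/negbTE -> /negbTE ->].
rewrite Ex_prod_pmf (bigD1 i)//= (bigD1 j)//= /F eqxx (negbTE ji) eqxx.
by rewrite big1 ?mulr1// => k /andP[/negbTE -> /negbTE ->]; exact: Ex_cst.
Qed.

End ProductPmf.

Section PairPmf.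
Context {R : realType} {T U : finType} (q : T -> R) (r : U -> R).

Definition pair_pmf (z : T * U) : R := q z.1 * r z.2.

Lemma Ex_pair_pmf (G : T * U -> R) :
  Ex pair_pmf G = Ex q (fun x => Ex r (fun y => G (x, y))).
Proof.
rewrite /Ex.
under [RHS]eq_bigr do rewrite mulr_sumr.
by rewrite pair_bigA; apply: eq_bigr => -[x y] _ /=; rewrite mulrA.
Qed.

Lemma Ex_pairM (G : T -> R) (H : U -> R) :
  Ex pair_pmf (fun z => G z.1 * H z.2) = Ex q G * Ex r H.
Proof.
rewrite Ex_pair_pmf mulr_suml; apply: eq_bigr => x _ /=.
by rewrite ExZ mulrA.
Qed.

Lemma pair_pmf_sum1 : \sum_x q x = 1 -> \sum_y r y = 1 ->
  \sum_z pair_pmf z = 1.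
Proof.
move=> q1 r1; have := Ex_pairM (fun=> 1) (fun=> 1).
rewrite (Ex_cst q1) (Ex_cst r1) mulr1 => <-; apply: eq_bigr => z _.
by rewrite !mulr1.
Qed.

Lemma Ex_pair_pmfl G : \sum_y r y = 1 ->
  Ex pair_pmf (fun z => G z.1) = Ex q G.
Proof.
move=> r1; rewrite -[RHS]mulr1 -{1}(Ex_cst r1 1) -Ex_pairM.
by apply: eq_Ex => z; rewrite mulr1.
Qed.

Lemma Ex_pair_pmfr G : \sum_x q x = 1 ->
  Ex pair_pmf (fun z => G z.2) = Ex r G.
Proof.
move=> q1; rewrite -[RHS]mul1r -{1}(Ex_cst q1 1) -Ex_pairM.
by apply: eq_Ex => z; rewrite mul1r.
Qed.

End PairPmf.

Section RandK.
Context {R : realType} {d K : nat}.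
Hypotheses (K0 : (0 < K)%N) (Kd : (K <= d)%N).

Let binK0 : ('C(d, K)%:R : R) != 0.
Proof. by rewrite pnatr_eq0 -lt0n bin_gt0. Qed.

Lemma sum_uniform_subset_pmf (P : pred {set 'I_d}) :
  \sum_(A | P A) @uniform_subset_pmf R d K A =
  #|[set A : {set 'I_d} | P A & #|A| == K]|%:R / 'C(d, K)%:R.
Proof.
rewrite /uniform_subset_pmf -big_mkcondr sumr_const -[LHS]mulr_natl.
by congr (_%:R * _); apply: eq_card => A; rewrite inE.
Qed.

Lemma uniform_subset_pmf_sum1 : \sum_A @uniform_subset_pmf R d K A = 1.
Proof.
rewrite sum_uniform_subset_pmf; set s := [set _ | _ & _].
suff -> : #|s| = 'C(d, K) by rewrite divff.
by rewrite -[in RHS](card_ord d) -card_draws; apply: eq_card => A; rewrite !inE.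
Qed.

(** The subsets avoiding [j] are the [K]-subsets of its complement, so Pascal's rule leaves this
    count for those containing [j]. *)
Lemma card_subsets_containing (j : 'I_d) :
  #|[set A : {set 'I_d} | j \in A & #|A| == K]| = 'C(d.-1, K.-1).
Proof.
have d0 : (0 < d)%N by exact: leq_trans Kd.
pose B := [set A : {set 'I_d} | j \in A]%SET.
pose D := [set A : {set 'I_d} | #|A| == K]%SET.
have := cardsID B D; rewrite card_draws card_ord.
have -> : D :&: B = [set A : {set 'I_d} | j \in A & #|A| == K]%SET.
  by apply/setP => A; rewrite !inE andbC.
have -> : D :\: B = [set A : {set 'I_d} | A \subset [set~ j]%SET & #|A| == K]%SET.
  apply/setP => A; rewrite !inE; congr (_ && _).
  apply/idP/fintype.subsetP => [jA x xA|/(_ j)].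
    by rewrite !inE; apply: contraNneq jA => <-.
  by rewrite !inE eqxx; case: (j \in A) => // /(_ isT).
rewrite cards_draws cardsC1 card_ord.
have -> : 'C(d, K) = ('C(d.-1, K.-1) + 'C(d.-1, K))%N.
  by rewrite -[in LHS](prednK d0) -[in LHS](prednK K0) binS (prednK K0) addnC.
by move/addIn.
Qed.

Lemma Ex_mem_uniform_subset (j : 'I_d) :
  Ex (@uniform_subset_pmf R d K) (fun A => (j \in A)%:R) = K%:R / d%:R.
Proof.
have d0 : (0 < d)%N by exact: leq_trans Kd.
rewrite /Ex (eq_bigr (fun A : {set 'I_d} =>
  if j \in A then @uniform_subset_pmf R d K A else 0)); last first.
  by move=> A _; case: (j \in A); rewrite ?mulr1 ?mulr0.
rewrite -big_mkcond sum_uniform_subset_pmf card_subsets_containing.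
apply/eqP; rewrite eqr_div// ?pnatr_eq0 -?lt0n// -!natrM mulnC.
by have := mul_bin_diag d K.-1; rewrite (prednK K0) => ->.
Qed.

(** The relative error of rand-K on coordinate [j], whose value gets multiplied by
    [1 + randK_dev j A]. Its mean is 0 and its variance is exactly [d / K - 1]. *)
Definition randK_dev (j : 'I_d) (A : {set 'I_d}) : R :=
  (if j \in A then d%:R / K%:R else 0) - 1.

Let dK0 : (d%:R : R) != 0 /\ (K%:R : R) != 0.
Proof.
by split; rewrite pnatr_eq0 -lt0n//; exact: leq_trans Kd.
Qed.

Lemma Ex_randK_dev j : Ex (@uniform_subset_pmf R d K) (randK_dev j) = 0.
Proof.
have [d0 k0] := dK0.
rewrite (@eq_Ex _ _ _ _ (fun A : {set 'I_d} =>
  d%:R / K%:R * (j \in A)%:R + -1)); last first.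
  by move=> A; rewrite /randK_dev; case: ifP => _; rewrite ?mulr1 ?mulr0.
rewrite ExD ExZ Ex_mem_uniform_subset Ex_cst ?uniform_subset_pmf_sum1//.
by field; rewrite d0 k0.
Qed.

Lemma Ex_randK_dev_sqr j :
  Ex (@uniform_subset_pmf R d K) (fun A => randK_dev j A ^+ 2)
  = d%:R / K%:R - 1.
Proof.
have [d0 k0] := dK0.
rewrite (@eq_Ex _ _ _ _ (fun A : {set 'I_d} =>
  ((d%:R / K%:R) ^+ 2 - 2 * (d%:R / K%:R)) * (j \in A)%:R + 1)); last first.
  by move=> A; rewrite /randK_dev; case: ifP => _; rewrite /= ?mulr1 ?mulr0; ring.
rewrite ExD ExZ Ex_mem_uniform_subset Ex_cst ?uniform_subset_pmf_sum1//.
by field; rewrite d0 k0.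
Qed.

End RandK.

(** * One iteration on a single coordinate *)

Section CoordinateStep.
Context {R : realType}.

(* [m2] and [b] are the mean square and the mean of the clients' errors. *)
Lemma mixing_descent (rho w_av ws m2 b es ey : R) :
  rho * (2 + w_av + 2 * ws) = 1 -> 0 <= w_av -> 0 <= ws -> b ^+ 2 <= m2 ->
  ((1 - rho) ^+ 2 * m2 + 2 * rho * (1 - rho) * es * b + rho ^+ 2 * es ^+ 2
     + rho ^+ 2 * ws * (es - ey) ^+ 2)
  + 2 * (((1 - rho) * es + rho / 2 * ey + rho / 2 * b) ^+ 2
         + (rho / 2) ^+ 2 * w_av * (m2 - 2 * ey * b + ey ^+ 2))
  + ((ey + rho * (es - ey)) ^+ 2 + rho ^+ 2 * ws * (es - ey) ^+ 2)
  <= m2 + 2 * es ^+ 2 + ey ^+ 2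
     - rho * (m2 - 2 * es * b + es ^+ 2 + (es - ey) ^+ 2).
Proof.
move=> rhoE w0 ws0 var.
(* To first order in [rho] the energy changes by [- 2 * rho * D]. The second-order terms, variances
   included, are at most [rho ^+ 2 * (2 + w_av + 2 * ws) * D], which [rhoE] turns into [rho * D];
   half of the gain is left. *)
set D := m2 - 2 * es * b + es ^+ 2 + (es - ey) ^+ 2.
have rho2 : 0 <= rho ^+ 2 by rewrite sqr_ge0.
(* The averaged form of [(e - ey) ^+ 2 <= 2 * (e - es) ^+ 2 + 2 * (es - ey) ^+ 2]. *)
have D_ge : m2 - 2 * ey * b + ey ^+ 2 <= 2 * D.
  by rewrite /D; have := sqr_ge0 (b - 2 * es + ey); lra.
have B_le : (es - ey) ^+ 2 <= D.
  by rewrite /D; have := sqr_ge0 (b - es); lra.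
have DE : rho ^+ 2 * (2 + w_av + 2 * ws) * D = rho * D.
  by transitivity (rho * (2 + w_av + 2 * ws) * rho * D);
    [ring | rewrite rhoE mul1r].
have := ler_wpM2l (mulr_ge0 rho2 w0) D_ge.
have := mulr_ge0 rho2 (sqr_ge0 (ey - b)).
have := ler_wpM2l rho2 var.
have := ler_wpM2l (mulr_ge0 rho2 ws0) B_le.
move: DE; rewrite /D; lra.
Qed.

Section Inequality.
Variables (n : nat) (e v : 'I_n -> R) (es ey vs vy : R).
Variables (gamma p rho eta w ws : R).
Local Notation m := (n%:R : R).
Hypotheses (n0 : (0 < n)%N) (gamma0 : 0 < gamma) (p0 : 0 < p).
Hypotheses (eta0 : 0 < eta) (w0 : 0 <= w) (ws0 : 0 <= ws).
Hypothesis rhoE : rho * (2 + w / m + 2 * ws) = 1.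
Hypothesis etaE : eta * (1 + 2 * w + 2 * ws) = rho.
Hypothesis balanced : m^-1 * (\sum_i v i) + 2 * vs + vy = 0.

Let h := p * eta / gamma.
Let k := gamma / (p ^+ 2 * eta).

Lemma sum_sqr_addc (x c : R) (f : 'I_n -> R) :
  \sum_i (x * f i + c) ^+ 2 =
  x ^+ 2 * \sum_i f i ^+ 2 + 2 * x * c * \sum_i f i + m * c ^+ 2.
Proof.
have -> : m * c ^+ 2 = \sum_(i < n) c ^+ 2.
  by rewrite sumr_const card_ord mulr_natl.
rewrite !mulr_sumr -!big_split; apply: eq_bigr => i _ /=; ring.
Qed.

Definition primal_energy : R :=
  \sum_i e i ^+ 2 + 2 * m * es ^+ 2 + m * ey ^+ 2.

(** There is no term in [vs], which [balanced] determines from the other dual errors. *)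
Definition dual_energy : R := \sum_i v i ^+ 2 + m * vy ^+ 2.

(** This is [n] times the quantity [D] of [mixing_descent]. *)
Definition dispersion : R :=
  \sum_i (e i - es) ^+ 2 + m * (es - ey) ^+ 2.

(** The expected primal energy after a communication round, each square split into squared mean plus
    variance; the factor [w / m ^+ 2] is the variance of an average of uncorrelated errors.
    [dual_energy_comm] is its dual counterpart. *)
Definition primal_energy_comm : R :=
  \sum_i (((1 - rho) * e i + rho * es) ^+ 2 + rho ^+ 2 * ws * (es - ey) ^+ 2)
  + 2 * m * (((1 - rho) * es + rho / 2 * ey + rho / 2 * (m^-1 * \sum_i e i)) ^+ 2
             + (rho / 2) ^+ 2 * (w / m ^+ 2 * \sum_i (e i - ey) ^+ 2))
  + m * ((ey + rho * (es - ey)) ^+ 2 + rho ^+ 2 * ws * (es - ey) ^+ 2).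

Definition dual_energy_comm : R :=
  \sum_i ((v i - h * (e i - es)) ^+ 2
          + h ^+ 2 * (w * (e i - ey) ^+ 2 + ws * (es - ey) ^+ 2))
  + m * ((vy + h * (es - ey)) ^+ 2 + h ^+ 2 * ws * (es - ey) ^+ 2).

Let m0 : 0 < m. Proof. by rewrite ltr0n. Qed.

Lemma sqr_mean_le (f : 'I_n -> R) :
  (m^-1 * \sum_i f i) ^+ 2 <= m^-1 * \sum_i f i ^+ 2.
Proof.
set b := m^-1 * _.
have : 0 <= m^-1 * \sum_i (1 * f i + - b) ^+ 2.
  by rewrite mulr_ge0 ?invr_ge0 ?(ltW m0)// sumr_ge0// => i _; exact: sqr_ge0.
rewrite sum_sqr_addc.
have -> : m^-1 * (1 ^+ 2 * \sum_i f i ^+ 2 + 2 * 1 * - b * \sum_i f i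
                  + m * (- b) ^+ 2) =
  m^-1 * (\sum_i f i ^+ 2) - 2 * b * (m^-1 * \sum_i f i) + b ^+ 2.
  by field; rewrite gt_eqF.
rewrite -/b; lra.
Qed.

Lemma sum_sqr_sub (c : R) : \sum_i (e i - c) ^+ 2 =
  \sum_i e i ^+ 2 - 2 * c * \sum_i e i + m * c ^+ 2.
Proof.
under eq_bigr do rewrite -[e _]mul1r.
rewrite sum_sqr_addc; ring.
Qed.

Lemma primal_energy_comm_le :
  primal_energy_comm <= primal_energy - rho * dispersion.
Proof.
have := mixing_descent es ey rhoE (divr_ge0 w0 (ltW m0)) ws0 (sqr_mean_le e).
rewrite /primal_energy_comm /primal_energy /dispersion !sum_sqr_sub.
rewrite big_split/= sum_sqr_addc sumr_const card_ord.
rewrite -(mulr_natl (rho ^+ 2 * ws * (es - ey) ^+ 2)).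
set s2 := \sum_i e i ^+ 2; set s1 := \sum_i e i.
rewrite -(ler_pM2l m0); set A := (X in X <= _ -> _); set B := (X in _ <= X -> _).
have -> : A = (1 - rho) ^+ 2 * s2 + 2 * (1 - rho) * (rho * es) * s1 +
   m * (rho * es) ^+ 2 + m * (rho ^+ 2 * ws * (es - ey) ^+ 2) +
  2 * m * (((1 - rho) * es + rho / 2 * ey + rho / 2 * (m^-1 * s1)) ^+ 2
    + (rho / 2) ^+ 2 * (w / m ^+ 2 * (s2 - 2 * ey * s1 + m * ey ^+ 2)))
  + m * ((ey + rho * (es - ey)) ^+ 2 + rho ^+ 2 * ws * (es - ey) ^+ 2).
  by rewrite /A; field; rewrite gt_eqF.
have -> : B = s2 + 2 * m * es ^+ 2 + m * ey ^+ 2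
   - rho * (s2 - 2 * es * s1 + m * es ^+ 2 + m * (es - ey) ^+ 2).
  by rewrite /B; field; rewrite gt_eqF.
by [].
Qed.

Let cross := \sum_i v i * e i + 2 * m * (vs * es) + m * (vy * ey).

(** The balance replaces [es * \sum_i v i] by terms in [vs] and [vy], which makes the linear part
    the weighted inner product [cross]. In the quadratic part, the clients' variance costs [2 * w]
    because they compress differences to [ey], and the server's costs [2 * ws] because its message
    enters both [u_i] and [u_y]. *)
Lemma dual_energy_comm_le : dual_energy_comm <=
  dual_energy - 2 * h * cross + h ^+ 2 * (1 + 2 * w + 2 * ws) * dispersion.
Proof.
rewrite /dual_energy_comm /dual_energy.
have sv : \sum_i v i = - m * (2 * vs + vy).
  have : m * (m^-1 * (\sum_i v i) + 2 * vs + vy) = 0 by rewrite balanced mulr0.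
  by rewrite !mulrDr mulVKf ?gt_eqF//; lra.
have -> : \sum_i ((v i - h * (e i - es)) ^+ 2
          + h ^+ 2 * (w * (e i - ey) ^+ 2 + ws * (es - ey) ^+ 2)) =
  \sum_i v i ^+ 2 - 2 * h * (\sum_i v i * e i) + 2 * h * es * \sum_i v i
  + h ^+ 2 * (\sum_i (e i - es) ^+ 2) + h ^+ 2 * w * (\sum_i (e i - ey) ^+ 2)
  + m * (h ^+ 2 * ws * (es - ey) ^+ 2).
  have -> : m * (h ^+ 2 * ws * (es - ey) ^+ 2) =
    \sum_(i < n) h ^+ 2 * ws * (es - ey) ^+ 2.
    by rewrite sumr_const card_ord mulr_natl.
  rewrite -mulNr !mulr_sumr -!big_split; apply: eq_bigr => i _ /=; ring.
have D_ge : \sum_i (e i - ey) ^+ 2 <= 2 * dispersion.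
  rewrite /dispersion !sum_sqr_sub.
  have := ler_wpM2l (ltW m0) (sqr_mean_le e).
  have := mulr_ge0 (ltW m0) (sqr_ge0 (m^-1 * (\sum_i e i) - 2 * es + ey)).
  have E : m * (m^-1 * \sum_i e i) = \sum_i e i by rewrite mulVKf ?gt_eqF.
  rewrite mulVKf ?gt_eqF//; move: E; set b := m^-1 * _ => <-; lra.
have B_le : m * (es - ey) ^+ 2 <= dispersion.
  by rewrite lerDr sumr_ge0// => i _; exact: sqr_ge0.
have h2 : 0 <= h ^+ 2 by exact: sqr_ge0.
have := ler_wpM2l (mulr_ge0 h2 w0) D_ge.
have := ler_wpM2l (mulr_ge0 h2 ws0) B_le.
rewrite sv /cross; set s := \sum_i (e i - ey) ^+ 2.
rewrite /dispersion; set s' := \sum_i (e i - es) ^+ 2; set t := \sum_i _ ^+ 2.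
set u := \sum_i _; lra.
Qed.

(* [etaE] makes the variance injected into the dual variables equal to the gain
   [rho * dispersion] of the primal ones, and the cross terms complete the
   squares [(e - gamma * v) ^+ 2] because the dual errors are balanced. *)
Lemma coordinate_descent :
  p * (gamma^-1 * primal_energy_comm + k * dual_energy_comm)
  + (1 - p) * (gamma^-1 * primal_energy + k * dual_energy)
  <= gamma^-1 * (\sum_i (e i - gamma * v i) ^+ 2
                 + 2 * m * (es - gamma * vs) ^+ 2
                 + m * (ey - gamma * vy) ^+ 2)
     + (1 - p ^+ 2 * eta) * (k * dual_energy).
Proof.
have k0 : 0 <= k by rewrite divr_ge0 ?ltW// mulr_gt0// exprn_gt0.
have ig0 : 0 <= gamma^-1 by rewrite invr_ge0 ltW.
have gn : gamma != 0 by rewrite gt_eqF.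
have pn : p != 0 by rewrite gt_eqF.
have en : eta != 0 by rewrite gt_eqF.
have := ler_wpM2l (mulr_ge0 (ltW p0) ig0) primal_energy_comm_le.
have := ler_wpM2l (mulr_ge0 (ltW p0) k0) dual_energy_comm_le.
move=> H1 H2.
(* The weight [k] of the dual energy is such that [p * k * h = 1], so [cross] gets the coefficient
   needed to complete the squares. *)
have E1 : p * k * (2 * h * cross) = 2 * cross.
  by rewrite /k /h; field; rewrite ?gn ?pn ?en.
have E2 : p * k * (h ^+ 2 * (1 + 2 * w + 2 * ws) * dispersion)
   = p * gamma^-1 * (rho * dispersion).
  by rewrite -etaE /k /h; field; rewrite ?gn ?pn ?en.
(* Completing the squares consumes [gamma * dual_energy], which is the fraction [p ^+ 2 * eta] of
   the weighted dual energy: hence the dual rate. *)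
have E3 : p ^+ 2 * eta * (k * dual_energy) = gamma * dual_energy.
  by rewrite /k; field; rewrite ?gn ?pn ?en.
have E4 : gamma^-1 * (\sum_i (e i - gamma * v i) ^+ 2
                 + 2 * m * (es - gamma * vs) ^+ 2
                 + m * (ey - gamma * vy) ^+ 2)
  = gamma^-1 * primal_energy - 2 * cross
    + gamma * dual_energy + 2 * m * gamma * vs ^+ 2.
  have -> : \sum_i (e i - gamma * v i) ^+ 2 =
    \sum_i e i ^+ 2 - 2 * gamma * (\sum_i v i * e i)
    + gamma ^+ 2 * \sum_i v i ^+ 2.
    rewrite -mulNr !mulr_sumr -!big_split; apply: eq_bigr => i _ /=; ring.
  by rewrite /primal_energy /cross /dual_energy; field.
(* The server's square has no matching term in [dual_energy]; the one missing is nonnegative and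
   sits on the larger side. *)
have : 0 <= 2 * m * gamma * vs ^+ 2.
  by rewrite mulr_ge0 ?sqr_ge0// !mulr_ge0// ltW.
rewrite E4; move: E1 E2 E3 H1 H2.
move: (primal_energy) (dual_energy) (dispersion).
move: (primal_energy_comm) (dual_energy_comm).
move: (cross) (h) (k) (gamma^-1) => C H K g PC DC P D S.
lra.
Qed.

End Inequality.
End CoordinateStep.

Section ExpectedCoordinate.
Context {R : realType} {Z : finType} (q : Z -> R) (n : nat).
Variables (e v : 'I_n -> R) (es ey vy : R) (gamma p rho eta w ws : R).
Variables (xi : 'I_n -> Z -> R) (xis : Z -> R).
Local Notation m := (n%:R : R).
Hypothesis n0 : (0 < n)%N.
Hypothesis q1 : \sum_z q z = 1.
Hypothesis xi_mean : forall i, Ex q (xi i) = 0.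
Hypothesis xi_sqr : forall i, Ex q (fun z => xi i z ^+ 2) = w.
Hypothesis xi_pair : forall i j, i != j -> Ex q (fun z => xi i z * xi j z) = 0.
Hypothesis xis_mean : Ex q xis = 0.
Hypothesis xis_sqr : Ex q (fun z => xis z ^+ 2) = ws.
Hypothesis xi_xis : forall i, Ex q (fun z => xi i z * xis z) = 0.

Let as_ := es - ey.

Lemma Ex_sqr_affine a c : Ex q (fun z => (a + c * xis z) ^+ 2) =
  a ^+ 2 + c ^+ 2 * ws.
Proof.
rewrite (Ex_sqrD q1) ?ExZ ?xis_mean ?mulr0//; congr (_ + _).
by rewrite -xis_sqr -ExZ; apply: eq_Ex => z; rewrite exprMn.
Qed.

Lemma Ex_primal_energy :
  Ex q (fun z => primal_energy
    (fun i => (1 - rho) * e i + rho * (as_ * (1 + xis z) + ey))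
    ((1 - rho) * es + rho * ey
       + rho / 2 * (m^-1 * \sum_i (e i - ey) * (1 + xi i z)))
    (ey + rho * (as_ * (1 + xis z))))
  = primal_energy_comm e es ey rho w ws.
Proof.
rewrite /primal_energy /primal_energy_comm !ExD !ExZ Ex_sum.
congr (_ + _ * _ + _ * _).
- apply: eq_bigr => i _.
  rewrite (@eq_Ex _ _ _ _ (fun z =>
    (((1 - rho) * e i + rho * es) + rho * as_ * xis z) ^+ 2)); last first.
    by move=> z; rewrite /as_; ring.
  by rewrite Ex_sqr_affine /as_; ring.
- rewrite (@eq_Ex _ _ _ _ (fun z =>
    (((1 - rho) * es + rho * ey + rho / 2 * (m^-1 * \sum_i (e i - ey)))
      + \sum_i (rho / 2 * m^-1 * (e i - ey)) * xi i z) ^+ 2)); last first.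
    move=> z; congr (_ ^+ 2).
    have -> : \sum_i (rho / 2 * m^-1 * (e i - ey)) * xi i z =
              rho / 2 * m^-1 * \sum_i (e i - ey) * xi i z.
      by rewrite mulr_sumr; apply: eq_bigr => i _; rewrite !mulrA.
    have -> : \sum_i (e i - ey) * (1 + xi i z) =
              \sum_i (e i - ey) + \sum_i (e i - ey) * xi i z.
      by rewrite -big_split; apply: eq_bigr => i _; rewrite mulrDr mulr1.
    by ring.
  rewrite (Ex_sqrD q1); last first.
    by rewrite Ex_sum big1// => i _; rewrite ExZ xi_mean mulr0.
  rewrite (Ex_sqr_lincomb _ xi_sqr xi_pair); congr (_ ^+ 2 + _).
    rewrite sumrB sumr_const card_ord -(mulr_natl ey).
    by field; rewrite gt_eqF// ltr0n.
  rewrite mulrA mulrA !mulr_sumr; apply: eq_bigr => i _.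
  by field; rewrite gt_eqF// ltr0n.
- rewrite (@eq_Ex _ _ _ _ (fun z =>
    ((ey + rho * as_) + rho * as_ * xis z) ^+ 2)); last by move=> z; ring.
  by rewrite Ex_sqr_affine /as_; ring.
Qed.

Let h := p * eta / gamma.

(** A client's dual update mixes its own error with the server's, so [xi_xis] is what makes their
    variances add. *)
Lemma Ex_dual_energy :
  Ex q (fun z => dual_energy
    (fun i => v i - h * ((e i - ey) * (1 + xi i z) - as_ * (1 + xis z)))
    (vy + h * (as_ * (1 + xis z))))
  = dual_energy_comm e v es ey vy gamma p eta w ws.
Proof.
rewrite /dual_energy /dual_energy_comm !ExD !ExZ Ex_sum.
congr (_ + _ * _).
- apply: eq_bigr => i _.
  rewrite (@eq_Ex _ _ _ _ (fun z => ((v i - h * (e i - es))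
     + h * (as_ * xis z + (- (e i - ey)) * xi i z)) ^+ 2)); last first.
    by move=> z; rewrite /as_; ring.
  rewrite (Ex_sqrD q1); last first.
    by rewrite ExZ ExD !ExZ xis_mean xi_mean !mulr0 addr0 mulr0.
  congr (_ + _); rewrite (@eq_Ex _ _ _ _ (fun z => h ^+ 2 *
     (as_ ^+ 2 * xis z ^+ 2 + (2 * as_ * (- (e i - ey)) * (xi i z * xis z)
       + (e i - ey) ^+ 2 * xi i z ^+ 2)))); last by move=> z; ring.
  by rewrite ExZ !ExD !ExZ xi_xis xis_sqr xi_sqr /as_ -/h; ring.
- rewrite (@eq_Ex _ _ _ _ (fun z =>
    ((vy + h * as_) + h * as_ * xis z) ^+ 2)); last by move=> z; ring.
  by rewrite Ex_sqr_affine /as_ -/h; ring.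
Qed.

End ExpectedCoordinate.

(** * One iteration on vectors *)

Section SumOverCoordinates.
Context {R : realType} {n d : nat}.
Local Notation m := (n%:R : R).

Lemma sum_energy (X U : 'I_n -> 'rV[R]_d) (Xs Y Uy : 'rV[R]_d) (a b : R) :
  \sum_(j < d)
    (a * primal_energy (fun i => X i 0 j) (Xs 0 j) (Y 0 j)
     + b * dual_energy (fun i => U i 0 j) (Uy 0 j)) =
  a * (\sum_i sqnorm (X i) + 2 * m * sqnorm Xs + m * sqnorm Y)
  + b * (\sum_i sqnorm (U i) + m * sqnorm Uy).
Proof.
rewrite /sqnorm /primal_energy /dual_energy.
rewrite [in RHS]exchange_big /= [X in _ = _ + _ * (X + _)]exchange_big /=.
by rewrite [LHS]big_split /= -!mulr_sumr !big_split /= -!mulr_sumr.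
Qed.

Lemma primal_energy_sub (X U : 'I_n -> 'rV[R]_d) (Xs Y Us Uy : 'rV[R]_d)
    (c : R) j :
  \sum_i (X i 0 j - c * U i 0 j) ^+ 2 + 2 * m * (Xs 0 j - c * Us 0 j) ^+ 2
    + m * (Y 0 j - c * Uy 0 j) ^+ 2 =
  primal_energy (fun i => (X i - c *: U i) 0 j) ((Xs - c *: Us) 0 j)
    ((Y - c *: Uy) 0 j).
Proof.
rewrite /primal_energy !mxE; congr (_ + _ + _).
by apply: eq_bigr => i _; rewrite !mxE.
Qed.

End SumOverCoordinates.

Section ExpectedStep.
Context {R : realType} {n d : nat}.
Variables (L mu : R) (f : 'I_n -> 'rV[R]_d -> R) (fs g : 'rV[R]_d -> R).
Variables (xstar : 'rV[R]_d) (K Ks : nat) (p rho eta : R).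
Local Notation m := (n%:R : R).
Local Notation gamma := (L^-1).
Local Notation w := (d%:R / K%:R - 1 : R).
Local Notation ws := (d%:R / Ks%:R - 1 : R).

Definition const_params : params R :=
  {| Defs.gamma := gamma; Defs.eta := eta; Defs.eta_y := eta;
     Defs.rho := rho; Defs.rho_y := rho; Defs.prob := fun=> p |}.

Definition comm_noise : finType := ({ffun 'I_n -> {set 'I_d}} * {set 'I_d})%type.

(** The coordinate sets are drawn even when the coin is 0, so that all iterations share one finite
    noise type. *)
Definition noise : finType := (bool * comm_noise)%type.

Definition comm_pmf : comm_noise -> R :=
  pair_pmf (prod_pmf (@uniform_subset_pmf R d K)) (@uniform_subset_pmf R d Ks).

Definition noise_pmf : noise -> R := pair_pmf (bernoulli_pmf p) comm_pmf.

(** The time index 0 is arbitrary, since the communication probability is constant. *)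
Definition step (s : state R n d) (z : noise) : state R n d :=
  bicolor_step f fs g const_params 0 z.1 (fun i => randK K (z.2.1 i))
    (randK Ks z.2.2) s.

Local Notation Psi := (lyapunov f g gamma eta p xstar).

Hypotheses (n0 : (0 < n)%N) (L0 : 0 < L) (mu0 : 0 <= mu).
Hypotheses (fL : forall i, smooth L (f i))
           (fmu : forall i, strongly_convex mu (f i)).
Hypotheses (fsL : smooth L fs) (fsmu : strongly_convex mu fs).
Hypotheses (gL : smooth L g) (gmu : strongly_convex mu g).
Hypothesis xmin : is_minimizer (objective f fs g) xstar.
Hypotheses (K0 : (0 < K)%N) (Kd : (K <= d)%N).
Hypotheses (Ks0 : (0 < Ks)%N) (Ksd : (Ks <= d)%N).
Hypotheses (p0 : 0 < p) (eta0 : 0 < eta).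
Hypothesis rhoE : rho * (2 + w / m + 2 * ws) = 1.
Hypothesis etaE : eta * (1 + 2 * w + 2 * ws) = rho.

Lemma comm_pmf_sum1 : \sum_z comm_pmf z = 1.
Proof.
by apply: pair_pmf_sum1; rewrite ?prod_pmf_sum1 ?uniform_subset_pmf_sum1.
Qed.

Definition forward (h : 'rV[R]_d -> R) (x u : 'rV[R]_d) : 'rV[R]_d :=
  x - gamma *: grad h x + gamma *: u.

Lemma lyapunov_sqnorm s : Psi s =
  gamma^-1 * (\sum_i sqnorm (st_x s i - xstar) + 2 * m * sqnorm (st_xs s - xstar)
              + m * sqnorm (st_y s - xstar))
  + gamma / (p ^+ 2 * eta) * (\sum_i sqnorm (st_u s i - grad (f i) xstar)
              + m * sqnorm (st_uy s - grad g xstar)).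
Proof.
rewrite /lyapunov; congr (_ * (_ + _ * _ + _ * _) + _ * (_ + _ * _)).
- by apply: eq_bigr => i _; exact: enorm_sqr.
- exact: enorm_sqr.
- exact: enorm_sqr.
- by apply: eq_bigr => i _; exact: enorm_sqr.
- exact: enorm_sqr.
Qed.

Lemma lyapunov_ge0 s : 0 <= Psi s.
Proof.
have gamma0 : 0 <= gamma by rewrite invr_ge0 ltW.
have k0 : 0 <= gamma / (p ^+ 2 * eta).
  by rewrite divr_ge0// mulr_ge0 ?sqr_ge0// ltW.
have sum_ge0 (x : 'I_n -> 'rV[R]_d) : 0 <= \sum_i sqnorm (x i).
  by apply: sumr_ge0 => i _; exact: sqnorm_ge0.
rewrite lyapunov_sqnorm; apply: addr_ge0; apply: mulr_ge0 => //.
- by rewrite invr_ge0.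
- by apply: addr_ge0; [apply: addr_ge0|]; rewrite ?mulr_ge0 ?sqnorm_ge0.
- by apply: addr_ge0 => //; rewrite mulr_ge0 ?sqnorm_ge0.
Qed.

Lemma lyapunov_coordinates s : Psi s = \sum_(j < d)
  (gamma^-1 * primal_energy (fun i => (st_x s i - xstar) 0 j)
                ((st_xs s - xstar) 0 j) ((st_y s - xstar) 0 j)
   + gamma / (p ^+ 2 * eta) *
     dual_energy (fun i => (st_u s i - grad (f i) xstar) 0 j)
                ((st_uy s - grad g xstar) 0 j)).
Proof.
by rewrite lyapunov_sqnorm sum_energy. Qed.

Lemma randK_dev_mxE k (A : {set 'I_d}) (x : 'rV[R]_d) j :
  randK k A x 0 j = x 0 j * (1 + @randK_dev R d k j A).
Proof.
rewrite mxE /randK_dev addrC subrK; case: ifP => _; last by rewrite mulr0.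
by rewrite mulrC.
Qed.

(** The dual variable cancels: what remains is the difference of the plain gradient steps from [x]
    and from [xstar]. *)
Lemma step_contraction h (x : 'rV[R]_d) (u : 'rV[R]_d) :
  smooth L h -> strongly_convex mu h ->
  sqnorm ((forward h x u - xstar) - gamma *: (u - grad h xstar))
  <= (1 - mu / L) * sqnorm (x - xstar).
Proof.
move=> hL hmu; have := gradient_step_contraction x xstar L0 mu0 hL hmu.
congr (sqnorm _ <= _); apply/rowP => j; rewrite /forward !mxE; ring.
Qed.

Section OneStep.
Variable s : state R n d.
Let hx i := forward (f i) (st_x s i) (st_u s i).
Let hxs := forward fs (st_xs s) (st_us s).
Let hy := forward g (st_y s) (st_uy s).
Let e j i : R := (hx i - xstar) 0 j.
Let es j : R := (hxs - xstar) 0 j.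
Let ey j : R := (hy - xstar) 0 j.
Let v j i : R := (st_u s i - grad (f i) xstar) 0 j.
Let vs j : R := (st_us s - grad fs xstar) 0 j.
Let vy j : R := (st_uy s - grad g xstar) 0 j.
Let k := gamma / (p ^+ 2 * eta).

Lemma step_commE z : step s (true, z) =
  let c := fun i => randK K (z.1 i) (hx i - hy) in
  let cs := randK Ks z.2 (hxs - hy) in
  let cbar := m^-1 *: \sum_i c i in
  {| st_x := fun i => (1 - rho) *: hx i + rho *: (cs + hy);
     st_xs := (1 - (rho + rho) / 2) *: hxs + ((rho + rho) / 2) *: hy
              + (rho / 2) *: cbar;
     st_y := hy + rho *: cs;
     st_u := fun i => st_u s i - (p * eta / gamma) *: (c i - cs);
     st_us := st_us s + (p * eta / (2 * gamma)) *: cbar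
              - (p * (eta + eta) / (2 * gamma)) *: cs;
     st_uy := st_uy s + (p * eta / gamma) *: cs |}.
Proof. by []. Qed.

Lemma lyapunov_step0 z : Psi (step s (false, z)) = \sum_(j < d)
  (gamma^-1 * primal_energy (e j) (es j) (ey j)
   + k * dual_energy (v j) (vy j)).
Proof. exact: lyapunov_coordinates. Qed.

(** Exchanging the expectation with the sum over coordinates leaves, for each [j], only the moments
    of the errors on that coordinate; dependence between coordinates never appears. *)
Lemma Ex_lyapunov_step1 :
  Ex comm_pmf (fun z => Psi (step s (true, z))) = \sum_(j < d)
  (gamma^-1 * primal_energy_comm (e j) (es j) (ey j) rho w ws
   + k * dual_energy_comm (e j) (v j) (es j) (ey j) (vy j) gamma p eta w ws).
Proof.
have S1 := uniform_subset_pmf_sum1 (R := R) Kd.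
have Ss1 := uniform_subset_pmf_sum1 (R := R) Ksd.
have P1 := prod_pmf_sum1 (I := 'I_n) S1.
have xi1 (G : {set 'I_d} -> R) i : Ex comm_pmf (fun z => G (z.1 i)) =
    Ex (@uniform_subset_pmf R d K) G.
  rewrite (Ex_pair_pmfl _ (fun S : {ffun 'I_n -> {set 'I_d}} => G (S i)))//.
  by rewrite Ex_prod_pmf1.
have xis1 (G : {set 'I_d} -> R) : Ex comm_pmf (fun z => G z.2) =
    Ex (@uniform_subset_pmf R d Ks) G by exact: Ex_pair_pmfr.
under eq_Ex do rewrite lyapunov_coordinates.
rewrite Ex_sum; apply: eq_bigr => j _.
pose xi i (z : comm_noise) := @randK_dev R d K j (z.1 i).
pose xis (z : comm_noise) := @randK_dev R d Ks j z.2.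
have xi_mean i : Ex comm_pmf (xi i) = 0.
  by rewrite (xi1 (randK_dev j)) Ex_randK_dev.
have xi_sqr i : Ex comm_pmf (fun z => xi i z ^+ 2) = w.
  by rewrite (xi1 (fun A => randK_dev j A ^+ 2)) Ex_randK_dev_sqr.
have xis_mean : Ex comm_pmf xis = 0.
  by rewrite (xis1 (randK_dev j)) Ex_randK_dev.
have xis_sqr : Ex comm_pmf (fun z => xis z ^+ 2) = ws.
  by rewrite (xis1 (fun A => randK_dev j A ^+ 2)) Ex_randK_dev_sqr.
have xi_pair i i' : i != i' -> Ex comm_pmf (fun z => xi i z * xi i' z) = 0.
  move=> ii'; rewrite (Ex_pair_pmfl _
    (fun S : {ffun 'I_n -> {set 'I_d}} => randK_dev j (S i) * randK_dev j (S i')))//.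
  by rewrite Ex_prod_pmf2// Ex_randK_dev// mul0r.
have xi_xis i : Ex comm_pmf (fun z => xi i z * xis z) = 0.
  rewrite (Ex_pairM _ _
    (fun S : {ffun 'I_n -> {set 'I_d}} => randK_dev j (S i)) (randK_dev j)).
  by rewrite Ex_randK_dev// mulr0.
have P := comm_pmf_sum1.
rewrite ExD !ExZ; congr (_ * _ + _ * _).
- rewrite -(Ex_primal_energy (e j) (es j) (ey j) rho n0 P
    xi_mean xi_sqr xi_pair xis_mean xis_sqr).
  apply: eq_Ex => z; rewrite step_commE /= /e /es /ey /xi /xis.
  move: (hx) (hxs) (hy) => a b c; congr primal_energy.
  + by apply/funext => i; rewrite !(randK_dev_mxE, mxE); ring.
  + rewrite !(randK_dev_mxE, mxE) summxE.
    have -> : \sum_(i < n) ((a i - xstar) 0 j - (c 0 j - xstar 0 j))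
                 * (1 + @randK_dev R d K j (z.1 i)) =
              \sum_(i < n) randK K (z.1 i) (a i - c) 0 j.
      apply: eq_bigr => i _; rewrite !(randK_dev_mxE, mxE); ring.
    by field; rewrite gt_eqF// ltr0n.
  + by rewrite !(randK_dev_mxE, mxE); ring.
- rewrite -(Ex_dual_energy (e j) (v j) (es j) (ey j) (vy j) gamma p eta P
    xi_mean xi_sqr xis_mean xis_sqr xi_xis).
  apply: eq_Ex => z; rewrite step_commE /= /e /es /ey /v /vy /xi /xis.
  move: (hx) (hxs) (hy) => a b c; congr dual_energy.
  + by apply/funext => i; rewrite !(randK_dev_mxE, mxE); ring.
  + by rewrite !(randK_dev_mxE, mxE); ring.
Qed.

Lemma expected_step c : admissible_init s ->
  c <= mu / L -> c <= p ^+ 2 * eta ->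
  Ex noise_pmf (fun z => Psi (step s z)) <= (1 - c) * Psi s.
Proof.
move=> s_adm c1 c2; rewrite Ex_pair_pmf {1}/Ex big_bool /= Ex_lyapunov_step1.
under [X in _ + _ * X]eq_Ex do rewrite lyapunov_step0.
rewrite (Ex_cst comm_pmf_sum1).
have igamma0 : 0 < gamma by rewrite invr_gt0.
(* The difference of the balance of the dual variables and the optimality condition at [xstar]. *)
have balanced j : m^-1 * (\sum_i v j i) + 2 * vs j + vy j = 0.
  have := objective_grad_eq0 n0 L0 fL fsL gL xmin.
  move/(congr1 (fun x : 'rV[R]_d => x 0 j)).
  have := congr1 (fun x : 'rV[R]_d => x 0 j) s_adm.
  have -> : \sum_i v j i = (\sum_i st_u s i) 0 j - (\sum_i grad (f i) xstar) 0 j.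
    rewrite !summxE -sumrB; apply: eq_bigr => i _.
    by rewrite /v mxE [X in _ + X]mxE.
  rewrite /vs /vy; move: (grad fs xstar) (grad g xstar) => a b.
  move: (\sum_i st_u s i) (\sum_i grad (f i) xstar) => a' b'.
  rewrite !mxE; lra.
rewrite !mulr_sumr -big_split /=.
have w0 : 0 <= w by rewrite subr_ge0 ler_pdivlMr ?ltr0n// mul1r ler_nat.
have ws0 : 0 <= ws by rewrite subr_ge0 ler_pdivlMr ?ltr0n// mul1r ler_nat.
apply: le_trans (ler_sum _ (fun j _ => coordinate_descent (e j) (es j) (ey j)
  n0 igamma0 p0 eta0 w0 ws0 rhoE etaE (balanced j))) _.
pose ux i := st_u s i - grad (f i) xstar.
have -> : \sum_(j < d)
     (gamma^-1 *
      (\sum_i (e j i - gamma * v j i) ^+ 2 +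
       2 * m * (es j - gamma * vs j) ^+ 2 + m * (ey j - gamma * vy j) ^+ 2) +
      (1 - p ^+ 2 * eta) * (k * dual_energy (v j) (vy j))) =
  gamma^-1 * (\sum_i sqnorm ((hx i - xstar) - gamma *: ux i)
    + 2 * m * sqnorm ((hxs - xstar) - gamma *: (st_us s - grad fs xstar))
    + m * sqnorm ((hy - xstar) - gamma *: (st_uy s - grad g xstar)))
  + (1 - p ^+ 2 * eta) * (k * (\sum_i sqnorm (ux i)
      + m * sqnorm (st_uy s - grad g xstar))).
  rewrite [(1 - p ^+ 2 * eta) * _]mulrA -sum_energy; apply: eq_bigr => j _.
  rewrite [(1 - p ^+ 2 * eta) * _]mulrA.
  congr (_ * _ + _).
  exact: (primal_energy_sub (fun i => hx i - xstar) ux (hxs - xstar) (hy - xstar)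
    (st_us s - grad fs xstar) (st_uy s - grad g xstar)).
have le_c t : 0 <= t -> (1 - mu / L) * t <= (1 - c) * t.
  by move=> t0; rewrite ler_wpM2r// lerB.
rewrite lyapunov_sqnorm [leRHS]mulrDr; apply: lerD.
  rewrite [leRHS]mulrCA ler_pM2l ?invr_gt0// !(mulrDr (1 - c)).
  rewrite ![(1 - c) * (_ * sqnorm _)]mulrCA.
  have le_step h x u : smooth L h -> strongly_convex mu h ->
      sqnorm ((forward h x u - xstar) - gamma *: (u - grad h xstar))
      <= (1 - c) * sqnorm (x - xstar).
    by move=> hL hmu; apply: le_trans (le_c _ (sqnorm_ge0 _));
      exact: step_contraction.
  apply: lerD; first apply: lerD.
  - by rewrite mulr_sumr; apply: ler_sum => i _;
      exact: (le_step _ (st_x s i) (st_u s i) (fL i) (fmu i)).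
  - by apply: ler_wpM2l; [rewrite mulr_ge0 | exact: le_step].
  - by apply: ler_wpM2l => //; exact: le_step.
apply: ler_wpM2r; last by rewrite lerB.
apply: mulr_ge0; first by rewrite divr_ge0 ?mulr_ge0 ?sqr_ge0// ltW.
apply: addr_ge0; last by rewrite mulr_ge0 ?sqnorm_ge0.
by apply: sumr_ge0 => i _; exact: sqnorm_ge0.
Qed.

End OneStep.

(** In units of [p * eta / gamma], the weighted increments contain [cbar] with coefficients -1 + 1
    and [cs] with 1 - 2 + 1. *)
Lemma step_admissible s z : admissible_init s -> admissible_init (step s z).
Proof.
case: z => -[] z // s_adm.
pose hy := forward g (st_y s) (st_uy s).
pose c i := randK K (z.1 i) (forward (f i) (st_x s i) (st_u s i) - hy).
pose cs := randK Ks z.2 (forward fs (st_xs s) (st_us s) - hy).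
rewrite /admissible_init.
have -> : st_u (step s (true, z)) =
  fun i => st_u s i - (p * eta / gamma) *: (c i - cs) by [].
have -> : st_us (step s (true, z)) = st_us s
   + (p * eta / (2 * gamma)) *: (m^-1 *: \sum_i c i)
   - (p * (eta + eta) / (2 * gamma)) *: cs by [].
have -> : st_uy (step s (true, z)) = st_uy s + (p * eta / gamma) *: cs by [].
move: c cs => c cs.
rewrite sumrB -scaler_sumr sumrB sumr_const card_ord -(scaler_nat n cs).
rewrite -[RHS]s_adm.
move: (\sum_i st_u s i) (\sum_i c i) => a b.
apply/rowP => j; rewrite !mxE; field.
by rewrite !gt_eqF ?ltr0n.
Qed.

End ExpectedStep.

(** * Noise histories *)

Section Histories.
Context {R : realType} {N : finType} (q : N -> R).

(** Histories are plain sequences, so that one function runs the algorithm for every length, and the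
    newest draw comes last, as [foldl] expects. *)
Fixpoint histories (t : nat) : seq (seq N) :=
  if t is t'.+1 then [seq rcons h z | h <- histories t', z <- enum N]
  else [:: [::]].

Lemma mem_histories t h : (h \in histories t) = (size h == t).
Proof.
elim: t h => [|t IH] h; first by rewrite inE; case: h.
apply/allpairsP/eqP => [[[h' z] /= [hh' _ ->]]|].
  by rewrite size_rcons; move: hh'; rewrite IH => /eqP ->.
case/lastP: h => // h z; rewrite size_rcons => -[ht].
by exists (h, z); rewrite IH ht mem_enum.
Qed.

Lemma histories_uniq t : uniq (histories t).
Proof.
elim: t => // t IH; apply: allpairs_uniq => //; first exact: enum_uniq.
by move=> [h z] [h' z'] _ _ /= /rcons_inj[-> ->].
Qed.

Definition history_mean (t : nat) (F : seq N -> R) : R :=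
  \sum_(h <- histories t) (\prod_(z <- h) q z) * F h.

Lemma history_mean0 F : history_mean 0 F = F [::].
Proof. by rewrite /history_mean big_seq1 big_nil mul1r. Qed.

(** The tower rule: the inner [Ex] is the conditional expectation given the first [t] draws. *)
Lemma history_meanS t F :
  history_mean t.+1 F = history_mean t (fun h => Ex q (fun z => F (rcons h z))).
Proof.
rewrite /history_mean big_allpairs_dep; apply: eq_bigr => h _.
rewrite mulr_sumr big_enum; apply: eq_bigr => z _.
by rewrite big_rcons /= mulrA.
Qed.

Lemma history_mean_le t F G : (forall z, 0 <= q z) ->
  (forall h, size h = t -> F h <= G h) ->
  history_mean t F <= history_mean t G.
Proof.
move=> q0 FG; rewrite /history_mean big_seq [leRHS]big_seq.
apply: ler_sum => h; rewrite mem_histories => /eqP ht.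
by rewrite ler_wpM2l ?FG// prodr_ge0.
Qed.

Lemma history_meanZ t a F :
  history_mean t (fun h => a * F h) = a * history_mean t F.
Proof.
by rewrite /history_mean mulr_sumr; apply: eq_bigr => h _; rewrite mulrCA.
Qed.

Context {disp : measure_display} {Omega : measurableType disp}.
Variables (P : probability Omega R) (Z : nat -> Omega -> N).

Definition history (t : nat) (w : Omega) : seq N := mkseq (Z^~ w) t.

Hypothesis history_pmf : forall h : seq N,
  measurable (history (size h) @^-1` [set h]) /\
  P (history (size h) @^-1` [set h]) = (\prod_(z <- h) q z)%:E.

(** A function of the history is a finite combination of indicators of its level sets. These are
    measurable, or empty when the length of [h] is not [t]. *)
Lemma expectation_history t (F : seq N -> R) : (forall h, 0 <= F h) ->
  ('E_P[fun w => F (history t w)] = (history_mean t F)%:E)%E.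
Proof.
move=> F0; rewrite unlock.
pose A h := history t @^-1` [set h].
have mA h : measurable (A h).
  have [ht|ht] := eqVneq (size h) t.
    by rewrite /A -ht; have [] := history_pmf h.
  rewrite (_ : A h = set0)//; apply/seteqP; split => w //= Aw.
  by move: ht; rewrite -Aw size_mkseq eqxx.
have FE w : (F (history t w))%:E =
    (\sum_(h <- histories t) (F h * \1_(A h) w)%:E)%E.
  rewrite (bigD1_seq (history t w)) ?histories_uniq//=; last first.
    by rewrite mem_histories size_mkseq.
  rewrite big1 ?adde0 => [|h hw]; last first.
    rewrite indicE memNset ?mulr0// => /esym/eqP; exact/negP.
  by rewrite indicE mem_set// mulr1.
under eq_integral do rewrite FE.
rewrite ge0_integral_sum//; last 2 first.
- by move=> h; apply/measurable_EFinP/measurable_funM => //; exact: measurable_indic.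
- by move=> h w _; rewrite lee_fin mulr_ge0.
rewrite /history_mean -sumEFin big_seq [RHS]big_seq; apply: eq_bigr => h.
rewrite mem_histories => /eqP ht.
under eq_integral do rewrite EFinM.
rewrite ge0_integralZl_EFin//; last first.
  by apply/measurable_EFinP; exact: measurable_indic.
rewrite integral_indic// setIT [X in (_ * X)%E](_ : _ = (\prod_(z <- h) q z)%:E).
  by rewrite -EFinM mulrC.
by rewrite /A -ht; exact: (history_pmf h).2.
Qed.

End Histories.

Section IndependentNoise.
Context {R : realType} {n d K Ks : nat} {p : R}.
Context {disp : measure_display} {Omega : measurableType disp}.
Variables (P : probability Omega R) (theta : nat -> Omega -> bool).
Variables (S : 'I_n -> nat -> Omega -> {set 'I_d}).
Variables (Ss : nat -> Omega -> {set 'I_d}).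
Hypothesis theta_pmf : forall t, has_pmf P (theta t) (bernoulli_pmf p).
Hypothesis S_pmf : forall i t, has_pmf P (S i t) (@uniform_subset_pmf R d K).
Hypothesis Ss_pmf : forall t, has_pmf P (Ss t) (@uniform_subset_pmf R d Ks).
Hypothesis indep : mutually_independent P (noise_events theta S Ss).

Definition noise_at (t : nat) (w : Omega) : @noise n d :=
  (theta t w, ([ffun i => S i t w], Ss t w)).

Let key : eqType := (nat + nat * option 'I_n)%type.

Let source_key (s : nat) (o : option (option 'I_n)) : key :=
  if o is Some o' then inr (s, o') else inl s.

Let sources : seq (option (option 'I_n)) :=
  None :: Some None :: [seq Some (Some i) | i <- enum 'I_n].

Let keys (t : nat) : seq key :=
  [seq source_key s o | s <- iota 0 t, o <- sources].

(** A default for [nth], read only at indices below the length of the history. *)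
Let z0 : @noise n d := (false, ([ffun=> finset.set0], finset.set0)).

Let event (h : seq (@noise n d)) (k : key) : set Omega :=
  match k with
  | inl s => theta s @^-1` [set (nth z0 h s).1]
  | inr (s, Some i) => S i s @^-1` [set (nth z0 h s).2.1 i]
  | inr (s, None) => Ss s @^-1` [set (nth z0 h s).2.2]
  end.

Let keys_uniq t : uniq (keys t).
Proof.
apply: allpairs_uniq; first exact: iota_uniq.
  rewrite /= inE negb_or /= map_inj_uniq ?enum_uniq ?andbT; last by move=> ? ? [].
  by apply/andP; split; apply/mapP => -[].
by case=> s [x|] [s' [x'|]] _ _ //= => -[-> // ->].
Qed.

Let event_measurable h k : measurable (event h k).
Proof.
case: k => [s|[s [i|]]] /=; first by have [] := theta_pmf s (nth z0 h s).1.
  by have [] := S_pmf i s ((nth z0 h s).2.1 i).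
by have [] := Ss_pmf s (nth z0 h s).2.2.
Qed.

(** Prescribing the history means prescribing every source up to that time, an intersection over the
    duplicate-free list [keys], to which mutual independence applies. *)
Lemma noise_history_pmf (h : seq (@noise n d)) :
  measurable (history noise_at (size h) @^-1` [set h]) /\
  P (history noise_at (size h) @^-1` [set h]) =
    (\prod_(z <- h) @noise_pmf R n d K Ks p z)%:E.
Proof.
set t := size h.
have histE : history noise_at t @^-1` [set h] =
    \bigcap_(k in [set` keys t]) event h k.
  apply/seteqP; split => w /=.
    move=> hw k /= /allpairsP[[s x] /= [+ xS ->]].
    rewrite mem_iota add0n leq0n /= => st.
    have : nth z0 h s = noise_at s w by rewrite -hw nth_mkseq.
    by case: x xS => [[i|]|] _ /= ->//=; rewrite ffunE.
  move=> hw; apply: (@eq_from_nth _ z0); first by rewrite size_mkseq.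
  move=> s; rewrite size_mkseq => st; rewrite nth_mkseq//.
  have ks o : o \in sources -> event h (source_key s o) w.
    move=> oS; apply: hw => /=; apply/allpairsP; exists (s, o).
    by rewrite mem_iota add0n.
  have /= e1 := ks None isT.
  have /= e2 := ks (Some None) isT.
  have e3 i : S i s w = (nth z0 h s).2.1 i.
    by apply: (ks (Some (Some i))); rewrite !inE map_f ?mem_enum.
  rewrite /noise_at e1 e2; case: (nth z0 h s) e3 => [b [c c']] /= e3.
  by congr (_, (_, _)); apply/ffunP => i; rewrite ffunE.
split.
  by rewrite histE; apply: fin_bigcap_measurable => // k _; exact: event_measurable.
rewrite histE -[LHS]fineK ?fin_num_measure//; last first.
  by apply: fin_bigcap_measurable => // k _; exact: event_measurable.
rewrite indep//; last first.
  by move=> [s|[s [i|]]] _; exact: imageP.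
congr EFin; rewrite /keys big_allpairs_dep /=.
rewrite [RHS](big_nth z0) -/t /index_iota subn0; apply: eq_bigr => s _.
rewrite /sources !big_cons big_map big_enum /=.
rewrite (theta_pmf _ _).2 (Ss_pmf _ _).2 /=.
rewrite /noise_pmf /pair_pmf /comm_pmf /pair_pmf /prod_pmf.
congr (_ * _); rewrite mulrC; congr (_ * _).
by apply: eq_bigr => i _; rewrite (S_pmf i _ _).2.
Qed.

End IndependentNoise.

(** * Trajectories *)

Section Trajectory.
Context {R : realType} {n d : nat}.
Variables (L mu : R) (f : 'I_n -> 'rV[R]_d -> R) (fs g : 'rV[R]_d -> R).
Variables (xstar : 'rV[R]_d) (K Ks : nat) (p rho eta c : R).
Local Notation m := (n%:R : R).
Local Notation gamma := (L^-1).
Local Notation w := (d%:R / K%:R - 1 : R).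
Local Notation ws := (d%:R / Ks%:R - 1 : R).
Local Notation Psi := (lyapunov f g gamma eta p xstar).
Local Notation step := (step L f fs g K Ks p rho eta).

Hypotheses (n0 : (0 < n)%N) (L0 : 0 < L) (mu0 : 0 <= mu).
Hypotheses (fL : forall i, smooth L (f i))
           (fmu : forall i, strongly_convex mu (f i)).
Hypotheses (fsL : smooth L fs) (fsmu : strongly_convex mu fs).
Hypotheses (gL : smooth L g) (gmu : strongly_convex mu g).
Hypothesis xmin : is_minimizer (objective f fs g) xstar.
Hypotheses (K0 : (0 < K)%N) (Kd : (K <= d)%N).
Hypotheses (Ks0 : (0 < Ks)%N) (Ksd : (Ks <= d)%N).
Hypotheses (p01 : 0 < p <= 1) (eta0 : 0 < eta).
Hypothesis rhoE : rho * (2 + w / m + 2 * ws) = 1.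
Hypothesis etaE : eta * (1 + 2 * w + 2 * ws) = rho.
Hypotheses (c1 : c <= 1) (c_mu : c <= mu / L) (c_eta : c <= p ^+ 2 * eta).

Variable s0 : state R n d.
Hypothesis s0_adm : admissible_init s0.

Definition run (h : seq (@noise n d)) : state R n d := foldl step s0 h.

Lemma run_admissible h : admissible_init (run h).
Proof.
elim/last_ind: h => // h z IH; rewrite /run foldl_rcons.
exact: step_admissible.
Qed.

Lemma noise_pmf_ge0 z : 0 <= @noise_pmf R n d K Ks p z.
Proof.
have unif_ge0 k A : 0 <= @uniform_subset_pmf R d k A.
  by rewrite /uniform_subset_pmf; case: ifP => // _; rewrite invr_ge0.
have /andP[p0 p1] := p01.
rewrite /noise_pmf /comm_pmf /pair_pmf /prod_pmf !mulr_ge0 ?prodr_ge0//.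
by rewrite /bernoulli_pmf; case: z.1; [exact: ltW|rewrite subr_ge0].
Qed.

Lemma history_mean_lyapunov_le t :
  history_mean (@noise_pmf R n d K Ks p) t (fun h => Psi (run h))
  <= (1 - c) ^+ t * Psi s0.
Proof.
have /andP[p0 p1] := p01.
elim: t => [|t IH]; first by rewrite history_mean0 expr0 mul1r.
rewrite history_meanS exprS -mulrA.
apply: (@le_trans _ _ ((1 - c) * history_mean (@noise_pmf R n d K Ks p) t
  (fun h => Psi (run h)))); last by apply: ler_wpM2l => //; rewrite subr_ge0.
rewrite -history_meanZ; apply: history_mean_le; first exact: noise_pmf_ge0.
move=> h _; rewrite (_ : Ex _ _ =
  Ex (@noise_pmf R n d K Ks p) (fun z => Psi (step (run h) z))); last first.
  by apply: eq_Ex => z; rewrite /run foldl_rcons.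
exact: (expected_step n0 L0 mu0 fL fmu fsL fsmu gL gmu xmin K0 Kd Ks0 Ksd p0
  eta0 rhoE etaE (run_admissible h)).
Qed.

Context {disp : measure_display} {Omega : measurableType disp}.
Variables (P : probability Omega R) (theta : nat -> Omega -> bool).
Variables (S : 'I_n -> nat -> Omega -> {set 'I_d}).
Variables (Ss : nat -> Omega -> {set 'I_d}).
Hypothesis theta_pmf : forall t, has_pmf P (theta t) (bernoulli_pmf p).
Hypothesis S_pmf : forall i t, has_pmf P (S i t) (@uniform_subset_pmf R d K).
Hypothesis Ss_pmf : forall t, has_pmf P (Ss t) (@uniform_subset_pmf R d Ks).
Hypothesis indep : mutually_independent P (noise_events theta S Ss).

Lemma bicolor_run t w :
  bicolor f fs g (const_params L p rho eta) theta
    (fun i t w => randK K (S i t w)) (fun t w => randK Ks (Ss t w)) s0 t w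
  = run (history (noise_at theta S Ss) t w).
Proof.
elim: t => //= t ->; rewrite /history mkseqS /run foldl_rcons.
rewrite [RHS]/(step _ _) /=; congr bicolor_step.
by apply/funext => i; rewrite ffunE.
Qed.

Lemma expected_lyapunov_le t :
  ('E_P[fun w => Psi (bicolor f fs g (const_params L p rho eta) theta
      (fun i t w => randK K (S i t w)) (fun t w => randK Ks (Ss t w)) s0 t w)]
   <= ((1 - c) ^+ t * Psi s0)%:E)%E.
Proof.
rewrite [X in expectation _ X](_ : _ =
    fun w => Psi (run (history (noise_at theta S Ss) t w))); last first.
  by apply/funext => w; rewrite bicolor_run.
have F0 h : 0 <= Psi (run h) by exact: lyapunov_ge0.
have := expectation_history
  (noise_history_pmf theta_pmf S_pmf Ss_pmf indep) t F0.
by move=> ->; rewrite lee_fin history_mean_lyapunov_le.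
Qed.

End Trajectory.

(** * Complexity *)

Section AbsCeil.
Context {R : realType}.
Implicit Types x : R.
Local Notation up x := `|Num.ceil x|%N.

Let upE x : 0 <= x -> (up x)%:R = (Num.ceil x)%:~R :> R.
Proof.
move=> x0; have /gez0_abs <- : 0 <= Num.ceil x by rewrite ceil_ge0; lra.
by rewrite absz_nat.
Qed.

Lemma absz_ceil_ge x : 0 <= x -> x <= (up x)%:R.
Proof. by move=> x0; rewrite upE// ceil_ge. Qed.

Lemma absz_ceil_lt x : 0 <= x -> (up x)%:R < x + 1.
Proof. by move=> x0; rewrite upE//; have := ceilB1_lt x; rewrite intrB; lra. Qed.

Lemma absz_ceil_le x m : 0 <= x -> x <= m%:R -> (up x <= m)%N.
Proof.
by move=> x0 xm; rewrite -lez_nat gez0_abs ?ceil_le_int// ceil_ge0; lra.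
Qed.

Lemma absz_ceil_int x : 0 <= x -> x \is a Num.int -> (up x)%:R = x.
Proof. by move=> x0 xint; rewrite upE// ceilK. Qed.

End AbsCeil.

Section CompressionLevels.
Context {R : realType} (n d : nat) (alpha kappa : R).
Hypotheses (n0 : (0 < n)%N) (d0 : (0 < d)%N).
Hypotheses (alpha0 : 0 < alpha) (alpha1 : alpha <= 1) (kappa1 : 1 <= kappa).
Local Notation Ks := (K_down d kappa).
Local Notation K := (K_up n d alpha kappa).
Local Notation beta := (Num.max alpha n%:R^-1).

Let x := d%:R / Num.sqrt kappa.

Let sqrt_kappa_ge1 : 1 <= Num.sqrt kappa.
Proof. by rewrite -[1]sqrtr1 ler_wsqrtr. Qed.

Let x0 : 0 < x.
Proof. by rewrite divr_gt0 ?ltr0n// (lt_le_trans ltr01). Qed.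

Let beta_gt0 : 0 < beta. Proof. by rewrite lt_max alpha0. Qed.

Let beta_le1 : beta <= 1.
Proof. by rewrite ge_max alpha1 invf_le1 ?ltr0n// ler1n. Qed.

Let bx0 : 0 <= beta * x. Proof. by rewrite mulr_ge0// ltW. Qed.

Let KE : K = `|Num.ceil (beta * x)|%N. Proof. by rewrite /K_up -mulrA. Qed.

Lemma K_down_ge : d%:R / Num.sqrt kappa <= Ks%:R.
Proof. exact: absz_ceil_ge (ltW x0). Qed.

Lemma K_down_lt : Ks%:R < d%:R / Num.sqrt kappa + 1.
Proof. exact: absz_ceil_lt (ltW x0). Qed.

Let K_up_ge : beta * x <= K%:R.
Proof. by rewrite KE; exact: absz_ceil_ge. Qed.

Lemma K_up_gt0 : (0 < K)%N.
Proof. by rewrite -(ltr0n R); apply: lt_le_trans K_up_ge; rewrite mulr_gt0. Qed.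

Lemma K_up_le_down : (K <= Ks)%N.
Proof.
rewrite KE; apply: absz_ceil_le => //; apply: le_trans K_down_ge.
by rewrite -/x ler_piMl// ltW.
Qed.

Lemma K_down_le_dim : (Ks <= d)%N.
Proof.
apply: absz_ceil_le; first exact: ltW.
by rewrite ler_pdivrMr ?ler_peMr// (lt_le_trans ltr01).
Qed.

Lemma K_down_le_mul_up : (Ks <= n * K)%N.
Proof.
apply: absz_ceil_le; first exact: ltW.
rewrite natrM; apply: le_trans (ler_wpM2l _ K_up_ge) => //.
have nb : 1 <= n%:R * beta.
  apply: (@le_trans _ _ (n%:R * n%:R^-1)).
    by rewrite mulfV// pnatr_eq0 -lt0n.
  by rewrite ler_wpM2l// le_max lexx orbT.
by rewrite mulrA ler_peMl// ltW.
Qed.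

Lemma alpha_K_down_lt : alpha * Ks%:R < K%:R + alpha.
Proof.
have := K_down_lt; rewrite -/x -(ltr_pM2l alpha0) => h.
apply: lt_le_trans h _; rewrite mulrDr mulr1 lerD2r.
apply: le_trans K_up_ge; apply: ler_wpM2r; first exact: ltW.
by rewrite le_max lexx.
Qed.

(** Two cases where rounding does no harm: [Ks <= n * K] gives the bound at once, or [Ks] is not
    rounded at all. *)
Lemma alpha_K_down_le : alpha <= n%:R^-1 \/ d%:R / Num.sqrt kappa \is a Num.int ->
  alpha * Ks%:R <= K%:R.
Proof.
case=> [an|xint].
  have nR : 0 < n%:R :> R by rewrite ltr0n.
  have := K_down_le_mul_up; rewrite -(ler_nat R) natrM => h.
  apply: le_trans (ler_wpM2r _ an) _ => //.
  by rewrite mulrC ler_pdivrMr// mulrC.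
rewrite {1}/K_down absz_ceil_int ?(ltW x0)//.
apply: le_trans K_up_ge; apply: ler_wpM2r; first exact: ltW.
by rewrite le_max lexx.
Qed.

Let sqrtk0 : 0 < Num.sqrt kappa. Proof. exact: lt_le_trans ltr01 _. Qed.

Let Ks0 : 0 < Ks%:R :> R.
Proof. by apply: lt_le_trans K_down_ge. Qed.

Let sqK0 : 0 < Num.sqrt K%:R :> R. Proof. by rewrite sqrtr_gt0 ltr0n K_up_gt0. Qed.

Let sqKs0 : 0 < Num.sqrt Ks%:R :> R. Proof. by rewrite sqrtr_gt0. Qed.

Local Notation A := (d%:R * Num.sqrt K%:R * Num.sqrt kappa / Num.sqrt Ks%:R
           + d%:R ^+ 2 / Ks%:R).
Local Notation B := (d%:R * Num.sqrt kappa).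

Lemma complexity_le : A <= 2 * B.
Proof.
have -> : 2 * B = B + B by ring.
apply: lerD.
  rewrite ler_pdivrMr// mulrAC ler_wpM2l ?mulr_ge0 ?sqrtr_ge0//.
  by rewrite ler_wsqrtr// ler_nat K_up_le_down.
rewrite ler_pdivrMr// expr2 -!mulrA ler_wpM2l//.
by rewrite mulrC -ler_pdivrMr// K_down_ge.
Qed.

(** If [x >= 1], then [Ks <= 2 * x] and the second term of the sum is at least half of [B]. If
    [x < 1], both levels equal 1 and the first term is [B]. *)
Lemma complexity_ge : B <= 2 * A.
Proof.
have A1 : 0 <= d%:R * Num.sqrt K%:R * Num.sqrt kappa / Num.sqrt Ks%:R :> R.
  by rewrite divr_ge0 ?mulr_ge0 ?sqrtr_ge0.
have A2 : 0 <= d%:R ^+ 2 / Ks%:R :> R by rewrite divr_ge0 ?sqr_ge0.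
have [x1|x1] := leP 1 x.
  suff : B <= 2 * (d%:R ^+ 2 / Ks%:R) by lra.
  rewrite mulrA ler_pdivlMr// expr2.
  have : Ks%:R <= 2 * x by apply: le_trans (ltW K_down_lt) _; rewrite -/x; lra.
  rewrite -(ler_pM2l (mulr_gt0 (_ : 0 < d%:R) sqrtk0)) ?ltr0n// => h.
  apply: le_trans h _; rewrite le_eqVlt; apply/orP; left; apply/eqP.
  by rewrite /x; field; rewrite gt_eqF.
have KsE : Ks = 1%N.
  apply/eqP; rewrite eqn_leq; apply/andP; split; last by rewrite -(ltr0n R).
  by apply: absz_ceil_le; [exact: ltW|rewrite ltW].
have KE1 : K = 1%N.
  apply/eqP; rewrite eqn_leq K_up_gt0 andbT.
  by have := K_up_le_down; rewrite KsE.
have : d%:R * Num.sqrt K%:R * Num.sqrt kappa / Num.sqrt Ks%:R = B.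
  by rewrite KE1 KsE sqrtr1 divr1 mulr1.
have B0 : 0 <= B by rewrite mulr_ge0 ?sqrtr_ge0.
by lra.
Qed.

End CompressionLevels.

(** The witness is [c = p ^+ 2 * eta] in both cases; [p / c] equals the square root when [p] is the
    inverse square root, and [eta^-1] when [p = 1]. *)
Lemma rate_bound {R : realType} (eta kappa : R) :
  0 < eta -> eta <= 1 -> 1 <= kappa ->
  let p := Num.min (1 / Num.sqrt (eta * kappa)) 1 in
  exists c, [/\ 0 < p <= 1, 0 < c <= 1, c <= kappa^-1, c <= p ^+ 2 * eta &
    p / c <= Num.sqrt (kappa / eta) + eta^-1].
Proof.
move=> eta0 eta1 kappa1 p; have kappa0 : 0 < kappa by exact: lt_le_trans kappa1.
have ek0 : 0 < eta * kappa by rewrite mulr_gt0.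
have sek0 : 0 < Num.sqrt (eta * kappa) by rewrite sqrtr_gt0.
have p0 : 0 < p by rewrite lt_min divr_gt0 ?ltr01.
have p1 : p <= 1 by rewrite ge_min lexx orbT.
have ieta0 : 0 < eta^-1 by rewrite invr_gt0.
have [h|h] := leP (1 / Num.sqrt (eta * kappa)) 1.
- have pE : p = 1 / Num.sqrt (eta * kappa) by rewrite /p min_l.
  have p2 : p ^+ 2 * eta = kappa^-1.
    by rewrite pE div1r exprVn sqr_sqrtr ?ltW//; field; rewrite !gt_eqF.
  exists kappa^-1; split; rewrite ?p0 ?p2//.
    by rewrite invr_gt0 kappa0 invf_le1.
  rewrite invrK; suff -> : p * kappa = Num.sqrt (kappa / eta) by rewrite lerDl ltW.
  rewrite pE div1r sqrtrM ?ltW// [RHS]sqrtrM ?ltW// sqrtrV ?ltW//.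
  rewrite -[X in _ * X](sqr_sqrtr (ltW kappa0)).
  by field; rewrite !gt_eqF ?sqrtr_gt0.
- have pE : p = 1 by rewrite /p min_r// ltW.
  exists eta; rewrite pE expr1n !mul1r; split => //; rewrite ?ltr01 ?lexx ?eta0//.
    rewrite -[kappa^-1]mul1r ler_pdivlMr//.
    move: h; rewrite ltr_pdivlMr// mul1r -[X in _ < X]sqrtr1 ltr_sqrt//.
    exact: ltW.
  by rewrite lerDr sqrtr_ge0.
Qed.

Lemma hitting_time {R : realType} (a : nat -> \bar R) (c psi eps : R) :
  0 < c <= 1 -> 0 <= psi -> 0 < eps ->
  (forall t, (a t <= ((1 - c) ^+ t * psi)%:E)%E) ->
  exists T, iteration_complexity a eps T /\
    (eps <= psi -> T%:R <= ln (psi / eps) / c + 1).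
Proof.
move=> /andP[c0 c1] psi0 eps0 a_le.
pose l := ln (psi / eps) / c.
have small t : eps <= psi -> l <= t%:R -> (a t <= eps%:E)%E.
  move=> epsi lt; apply: le_trans (a_le t) _; rewrite lee_fin.
  have ppos : 0 < psi by exact: lt_le_trans epsi.
  have e : (1 - c) ^+ t <= expR (- (c * t%:R)).
    rewrite -mulNr mulrC expRM_natl lerXn2r ?nnegrE ?subr_ge0 ?expR_ge0//.
    exact: expR_ge1Dx.
  apply: le_trans (ler_wpM2r psi0 e) _.
  rewrite expRN ler_pdivrMl ?expR_gt0// mulrC -ler_pdivrMl//.
  rewrite -[leLHS]lnK ?posrE ?mulr_gt0 ?invr_gt0// ler_expR mulrC.
  by move: lt; rewrite /l ler_pdivrMr// [_ * c]mulrC.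
have hit : exists t, (a t <= eps%:E)%E.
  (* When [psi < eps] the accuracy is already reached at time 0. *)
  have [epsi|psie] := leP eps psi; last first.
    exists 0%N; apply: le_trans (a_le 0%N) _.
    by rewrite lee_fin expr0 mul1r ltW.
  pose l' : R := Num.max l 0; exists `|Num.ceil l'|%N; apply: small => //.
  apply: (@le_trans _ _ l'); first by rewrite le_max lexx.
  by rewrite absz_ceil_ge// le_max lexx orbT.
exists (ex_minn hit); case: ex_minnP => T aT Tmin; split.
  split => // t tT; rewrite ltNge; apply/negP => /Tmin.
  by rewrite leqNgt tT.
move=> epsi; have l0 : 0 <= l.
  by rewrite divr_ge0 ?ln_ge0 ?ler_pdivlMr ?mul1r// ltW.
apply: le_trans (ltW (absz_ceil_lt l0)); rewrite ler_nat; apply: Tmin.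
by apply: small => //; exact: absz_ceil_ge.
Qed.

Lemma eta_inv_le {R : realType} (n d K Ks : nat) :
  (0 < n)%N -> (0 < K)%N -> (K <= Ks)%N -> (Ks <= d)%N -> (Ks <= n * K)%N ->
  let w := d%:R / K%:R - 1 : R in
  let ws := d%:R / Ks%:R - 1 : R in
  [/\ 0 <= w, 0 <= ws & (1 + 2 * w + 2 * ws) * (2 + w / n%:R + 2 * ws)
    <= 12 * (d%:R ^+ 2 / (K%:R * Ks%:R))].
Proof.
move=> n0 K0 KKs Ksd KsnK w ws.
have nR : 0 < n%:R :> R by rewrite ltr0n.
have KR : 0 < K%:R :> R by rewrite ltr0n.
have KsR : 0 < Ks%:R :> R by rewrite ltr0n (leq_trans K0).
have w0 : 0 <= w.
  by rewrite subr_ge0 ler_pdivlMr// mul1r ler_nat (leq_trans KKs).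
have ws0 : 0 <= ws by rewrite subr_ge0 ler_pdivlMr// mul1r ler_nat.
split => //.
have le1 : d%:R / Ks%:R <= d%:R / K%:R :> R.
  by rewrite ler_wpM2l// lef_pV2 ?posrE// ler_nat.
have le2 : d%:R / K%:R / n%:R <= d%:R / Ks%:R :> R.
  rewrite -mulrA -invfM ler_wpM2l// lef_pV2 ?posrE ?mulr_gt0//.
  by rewrite mulrC -natrM ler_nat.
(* The constant 12 is 4 * 3. The factor 4 comes from [K <= Ks], and the 3 below from [Ks <= n * K],
   which bounds [w / n] by [d / Ks]. *)
have f1 : 1 + 2 * w + 2 * ws <= 4 * (d%:R / K%:R) by rewrite /w /ws; lra.
have f2 : 2 + w / n%:R + 2 * ws <= 3 * (d%:R / Ks%:R).
  have : w / n%:R <= d%:R / K%:R / n%:R.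
    by apply: ler_wpM2r; [rewrite invr_ge0 ltW | rewrite /w; lra].
  by rewrite /ws; lra.
have -> : 12 * (d%:R ^+ 2 / (K%:R * Ks%:R)) =
  4 * (d%:R / K%:R) * (3 * (d%:R / Ks%:R)) :> R by field; rewrite !gt_eqF.
have wn : 0 <= w / n%:R by rewrite divr_ge0// ltW.
by apply: ler_pM => //; lra.
Qed.

Lemma round_cost_le {R : realType} (D k s kappa eta : R) :
  0 < k -> 0 < s -> 0 <= D -> 0 < eta -> 0 < kappa ->
  eta^-1 <= 12 * (D ^+ 2 / (k * s)) ->
  k * (Num.sqrt (kappa / eta) + eta^-1) <=
  12 * (D * Num.sqrt k * Num.sqrt kappa / Num.sqrt s + D ^+ 2 / s).
Proof.
move=> k0 s0 D0 eta0 kappa0 etaV.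
have sk : 0 < Num.sqrt k by rewrite sqrtr_gt0.
have ss : 0 < Num.sqrt s by rewrite sqrtr_gt0.
rewrite !mulrDr; apply: lerD; last first.
  apply: le_trans (ler_wpM2l (ltW k0) etaV) _.
  by rewrite le_eqVlt; apply/orP; left; apply/eqP; field; rewrite !gt_eqF.
(* The 4 is an integer upper bound for the square root of 12. *)
have h : Num.sqrt eta^-1 <= 4 * (D / (Num.sqrt k * Num.sqrt s)).
  have q0 : 0 <= 4 * (D / (Num.sqrt k * Num.sqrt s)).
    by rewrite mulr_ge0// divr_ge0// mulr_ge0 ?ltW.
  rewrite -[leRHS]ger0_norm// -sqrtr_sqr ler_wsqrtr//.
  apply: le_trans etaV _; rewrite !exprMn exprVn exprMn.
  rewrite (sqr_sqrtr (ltW k0)) (sqr_sqrtr (ltW s0)).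
  have : 0 <= D ^+ 2 / (k * s) by rewrite divr_ge0 ?sqr_ge0// ltW// mulr_gt0.
  by lra.
rewrite (sqrtrM _ (ltW kappa0)) [leLHS]mulrA.
apply: le_trans (ler_wpM2l (mulr_ge0 (ltW k0) (sqrtr_ge0 kappa)) h) _.
have -> : k * Num.sqrt kappa * (4 * (D / (Num.sqrt k * Num.sqrt s))) =
  4 * (D * Num.sqrt k * Num.sqrt kappa / Num.sqrt s).
  by rewrite -{1}(sqr_sqrtr (ltW k0)); field; rewrite !gt_eqF.
apply: ler_wpM2r; last by lra.
by rewrite divr_ge0 ?mulr_ge0 ?sqrtr_ge0// ltW.
Qed.

Lemma totalcom_le {R : realType} (c2 k s alpha p T c l l0 b bs M : R) :
  0 <= c2 -> 0 < k -> 0 <= p -> 0 <= T -> 0 < c <= 1 -> 0 < l0 <= l ->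
  0 <= alpha -> b <= c2 * k -> bs <= c2 * s -> alpha * s <= 2 * k ->
  T <= l / c + 1 -> k * (p / c) <= M ->
  (b + alpha * bs) * (p * T) <= 3 * c2 * (1 + l0^-1) * (M * l).
Proof.
move=> c2_0 k0 p0 T0 /andP[c0 c1] /andP[l0_0 l0l] alpha0 bk bss ask Tl kM.
have l_0 : 0 < l by exact: lt_le_trans l0l.
have bits : b + alpha * bs <= 3 * (c2 * k).
  have := ler_wpM2l alpha0 bss; have := ler_wpM2l c2_0 ask.
  by move: bk; lra.
(* Since [c <= 1] and [l0 <= l], the extra iteration due to rounding is absorbed into the
   logarithmic term. *)
have one_le : 1 <= l0^-1 * (l / c).
  rewrite mulrC ler_pdivlMr// mul1r ler_pdivlMr//.
  by apply: le_trans l0l; rewrite ler_piMr// ltW.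
have T_le : T <= (1 + l0^-1) * (l / c) by move: Tl one_le; lra.
apply: le_trans (ler_wpM2r (mulr_ge0 p0 T0) bits) _.
have ck0 : 0 <= 3 * (c2 * k) by rewrite !mulr_ge0// ltW.
apply: le_trans (ler_wpM2l ck0 (ler_wpM2l p0 T_le)) _.
have il0 : 0 < l0^-1 by rewrite invr_gt0.
have h0 : 0 <= 3 * c2 * (1 + l0^-1) * l.
  by apply: mulr_ge0; [apply: mulr_ge0; [rewrite mulr_ge0|lra]|exact: ltW].
have := ler_wpM2l h0 kM; congr (_ <= _); last by ring.
by field; rewrite !gt_eqF.
Qed.

(** A single constant has to serve both forms of the bound: passing from [A] to [B] costs [2 * C],
    and the added 2 lets the same constant cover the comparison of [A] with [B]. *)
Lemma comparable_bounds {R : realType} (C A B l x : R) :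
  0 <= C -> 0 <= A -> 0 <= B -> A <= 2 * B -> 0 <= l -> x <= C * (A * l) ->
  x <= (2 + 2 * C) * (A * l) /\ x <= (2 + 2 * C) * (B * l).
Proof.
move=> C0 A0 B0 AB l0 xle.
have := mulr_ge0 A0 l0; have := mulr_ge0 B0 l0.
have := mulr_ge0 C0 (mulr_ge0 A0 l0).
have := ler_wpM2l C0 (ler_wpM2r l0 AB).
by split; lra.
Qed.

Theorem corollary4p2 (R : realType) (c1 c2 delta : R)
    (hc1 : 0 < c1) (hc2 : 0 < c2) (hdelta0 : 0 < delta) (hdelta1 : delta < 1) :
  exists C : R, 0 < C /\
  forall (n d : nat) (mu L alpha : R)
    (f : 'I_n -> 'rV[R]_d -> R) (fs g : 'rV[R]_d -> R) (xstar : 'rV[R]_d),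
  (0 < n)%N -> (0 < d)%N -> 0 < mu -> mu <= L -> 0 < alpha -> alpha <= 1 ->
  (forall i : 'I_n, smooth L (f i) /\ strongly_convex mu (f i)) ->
  smooth L fs -> strongly_convex mu fs ->
  smooth L g -> strongly_convex mu g ->
  is_minimizer (objective f fs g) xstar ->
  let kappa := L / mu in
  let Ks := K_down d kappa in
  let K := K_up n d alpha kappa in
  let omega := d%:R / K%:R - 1 in
  let omega_s := d%:R / Ks%:R - 1 in
  let omega_av := omega / n%:R in
  let rho := 1 / (2 + omega_av + 2 * omega_s) in
  let eta := 1 / ((1 + 2 * omega + 2 * omega_s)
                  * (2 + omega_av + 2 * omega_s)) in
  let p := Num.min (1 / Num.sqrt (eta * kappa)) 1 in
  let gamma := 1 / L in
  let a := {| Defs.gamma := gamma; Defs.eta := eta; Defs.eta_y := eta;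
              Defs.rho := rho; Defs.rho_y := rho; Defs.prob := fun=> p |} in
  let A := d%:R * Num.sqrt K%:R * Num.sqrt kappa / Num.sqrt Ks%:R
           + d%:R ^+ 2 / Ks%:R in
  let B := d%:R * Num.sqrt kappa in
  [/\ (K <= Ks)%N /\ (Ks <= n * K)%N,
      alpha * Ks%:R < K%:R + alpha,
      alpha <= n%:R^-1 \/ d%:R / Num.sqrt kappa \is a Num.int ->
        alpha * Ks%:R <= K%:R,
      A <= C * B /\ B <= C * A
    & forall (disp : measure_display) (Omega : measurableType disp)
        (P : probability Omega R) (theta : nat -> Omega -> bool)
        (S : 'I_n -> nat -> Omega -> {set 'I_d})
        (Ss : nat -> Omega -> {set 'I_d}) (s0 : state R n d) (b bs : nat),
      (forall t : nat, has_pmf P (theta t) (bernoulli_pmf (prob a t.+1))) ->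
      (forall (i : 'I_n) (t : nat),
         has_pmf P (S i t) (@uniform_subset_pmf R d K)) ->
      (forall t : nat, has_pmf P (Ss t) (@uniform_subset_pmf R d Ks)) ->
      mutually_independent P (noise_events theta S Ss) ->
      admissible_init s0 ->
      c1 * K%:R <= b%:R -> b%:R <= c2 * K%:R ->
      c1 * Ks%:R <= bs%:R -> bs%:R <= c2 * Ks%:R ->
      let Psi := lyapunov f g gamma eta p xstar in
      let EPsi := fun t : nat =>
        ('E_P[fun w : Omega =>
           Psi (bicolor f fs g a theta (fun i t w => randK K (S i t w))
                  (fun t w => randK Ks (Ss t w)) s0 t w)])%E in
      forall eps : R, 0 < eps ->
      exists T : nat, iteration_complexity EPsi eps T /\
        (eps <= delta * Psi s0 ->
         totalcom alpha b bs p T <= C * (A * ln (Psi s0 / eps)) /\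
         totalcom alpha b bs p T <= C * (B * ln (Psi s0 / eps)))].
Proof.
pose l0 := ln delta^-1.
have l0_gt0 : 0 < l0 by rewrite ln_gt0// invf_gt1.
(* The factor 12 comes from [round_cost_le] and the rest from [totalcom_le]. *)
pose C := 3 * c2 * (1 + l0^-1) * 12.
have C_gt0 : 0 < C.
  by rewrite /C !mulr_gt0// addr_gt0// invr_gt0.
exists (2 + 2 * C); split; first by lra.
move=> n d mu L alpha f fs g xstar n0 d0 mu0 muL alpha0 alpha1 fP fsL fsmu gL gmu
  xmin kappa Ks K omega omega_s omega_av rho eta p gamma a A B.
have L0 : 0 < L by exact: lt_le_trans muL.
have kappa1 : 1 <= kappa by rewrite ler_pdivlMr// mul1r.
have kappa0 : 0 < kappa by exact: lt_le_trans kappa1.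
have K0 : (0 < K)%N by exact: K_up_gt0.
have KKs : (K <= Ks)%N by exact: K_up_le_down.
have Ksd : (Ks <= d)%N by exact: K_down_le_dim.
have KsnK : (Ks <= n * K)%N by exact: K_down_le_mul_up.
have Ks0 : (0 < Ks)%N by exact: leq_trans KKs.
have KR : 1 <= K%:R :> R by rewrite ler1n.
have KsR : 0 < Ks%:R :> R by rewrite ltr0n.
have alphaKs : alpha * Ks%:R < K%:R + alpha by exact: alpha_K_down_lt.
(* Rounding costs less than [alpha], and [alpha <= 1 <= K]. *)
have alphaKs2 : alpha * Ks%:R <= 2 * K%:R by lra.
have AB : A <= 2 * B by exact: complexity_le.
have BA : B <= 2 * A by exact: complexity_ge.
have B0 : 0 <= B by rewrite mulr_ge0 ?sqrtr_ge0.
have A0 : 0 <= A by lra.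
split => //; first exact: alpha_K_down_le.
  by have := mulr_ge0 (ltW C_gt0) A0; have := mulr_ge0 (ltW C_gt0) B0; split; lra.
move=> disp Omega P theta S Ss s0 b bs theta_pmf S_pmf Ss_pmf indep s0_adm
  _ bK _ bsKs Psi EPsi eps eps0.
have [omega0 omega_s0 etaV] := eta_inv_le (R := R) n0 K0 KKs Ksd KsnK.
rewrite -/omega -/omega_s in omega0 omega_s0 etaV.
have omega_av0 : 0 <= omega_av by rewrite divr_ge0.
have r0 : 0 < 2 + omega_av + 2 * omega_s by lra.
have q0 : 0 < 1 + 2 * omega + 2 * omega_s by lra.
have eta0 : 0 < eta by rewrite divr_gt0// mulr_gt0.
have eta1 : eta <= 1.
  rewrite /eta div1r invf_le1 ?mulr_gt0//; apply: mulr_ege1; first by lra.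
  by rewrite -addrA ler_wpDr// ?addr_ge0 ?mulr_ge0// ler1n.
have rhoE : rho * (2 + omega_av + 2 * omega_s) = 1.
  by rewrite /rho mul1r mulVf ?gt_eqF.
have etaE : eta * (1 + 2 * omega + 2 * omega_s) = rho.
  by rewrite /eta /rho; field; rewrite !gt_eqF.
have [c [p01 c01 c_kappa c_eta pc]] := rate_bound eta0 eta1 kappa1.
have /andP[c_gt0 c_le1] := c01; have /andP[p_gt0 _] := p01.
have c_mu : c <= mu / L by rewrite -invf_div.
have gammaE : gamma = L^-1 by rewrite /gamma div1r.
have EPsi_le t : (EPsi t <= ((1 - c) ^+ t * Psi s0)%:E)%E.
  rewrite /EPsi /Psi /a gammaE.
  exact: (expected_lyapunov_le n0 L0 (ltW mu0) (fun i => (fP i).1)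
    (fun i => (fP i).2) fsL fsmu gL gmu xmin K0 (leq_trans KKs Ksd) Ks0 Ksd p01
    eta0 rhoE etaE c_le1 c_mu c_eta s0_adm theta_pmf S_pmf Ss_pmf indep).
have Psi0 : 0 <= Psi s0 by rewrite /Psi gammaE; exact: lyapunov_ge0.
have [T [T_hit T_le]] := hitting_time c01 Psi0 eps0 EPsi_le.
exists T; split => // epsd.
have Psi_gt0 : 0 < Psi s0.
  by rewrite -(pmulr_rgt0 _ hdelta0); exact: lt_le_trans epsd.
have eps_le : eps <= Psi s0.
  by apply: le_trans epsd _; rewrite ler_piMl// ltW.
have l0_le : l0 <= ln (Psi s0 / eps).
  rewrite ler_ln ?posrE ?invr_gt0 ?divr_gt0// ler_pdivlMr//.
  by rewrite mulrC ler_pdivrMr// mulrC.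
have cost : K%:R * (p / c) <= 12 * A.
  apply: le_trans (ler_wpM2l _ pc) _ => //.
  apply: round_cost_le => //; first lra.
  by rewrite /eta div1r invrK.
have l0l : 0 < l0 <= ln (Psi s0 / eps) by rewrite l0_gt0.
have main : totalcom alpha b bs p T <= C * (A * ln (Psi s0 / eps)).
  have -> : C * (A * ln (Psi s0 / eps)) =
    3 * c2 * (1 + l0^-1) * (12 * A * ln (Psi s0 / eps)) by rewrite /C; ring.
  exact: (totalcom_le (ltW hc2) (lt_le_trans ltr01 KR) (ltW p_gt0) (ler0n _ T)
    c01 l0l (ltW alpha0) bK bsKs alphaKs2 (T_le eps_le) cost).
have ln0 : 0 <= ln (Psi s0 / eps) by apply: le_trans l0_le; exact: ltW.
exact: (comparable_bounds (ltW C_gt0)).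
Qed.
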